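(* There are Legendrian knots $\Lambda$ in $(\mathbb{R}^3,\ker(dz-y\,dx))$ (with rotation number $0$) such that for any integer $n\geq 2$, there is a $\mathbb{Z}$-valued augmentation $\epsilon_n\colon \mathcal{A}_\Lambda\to\mathbb{Z}$ of the Chekanov--Eliashberg DGA $(\mathcal{A}_\Lambda,\partial)$ of $\Lambda$ for which the linearized contact homology $\mathrm{LCH}_*^{\epsilon_n}(\Lambda)$ (over $\mathbb{Z}$) contains a $\mathbb{Z}/n$ summand.
   Context: All Legendrian knots are in $\mathbb{R}^3$ with contact structure $\ker(dz-y\,dx)$ and have rotation number $0$. Fronts. A generic Legendrian knot $\Lambda$ is represented by its front projection to the $xz$-plane, whose only singularities are transverse double points (crossings) and left/right semicubical cusps; at a crossing the strand of lower slope is the overstrand. A front is simple if all right cusps have the same $x$-coordinate; every Legendrian knot is Legendrian isotopic to one with simple front. The resolution of a front is a knot diagram obtained by smoothing left cusps, replacing double points by crossings (lower slope strand over), and replacing each right cusp by a small loop with one crossing (again the strand of lower slope over, the loop lying to the right of the crossing); it is, up to planar isotopy, the Lagrangian ($xy$-)projection of a knot Legendrian isotopic to $\Lambda$. The crossings of the resolution (the Reeb chords) correspond to the crossings and right cusps of the front. Chekanov--Eliashberg DGA. Take a simple front of $\Lambda$ with Reeb chords $a_1,\dots,a_m$, an orientation, and a base point away from the crossings. Let $\mathcal{A}_\Lambda=\mathbb{Z}\langle a_1,\dots,a_m,t^{\pm1}\rangle$, the free unital associative algebra with the only relations $t t^{-1}=t^{-1}t=1$. Grading: $|t^{\pm1}|=0$;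 $|a_i|=1$ if $a_i$ is a right cusp; if $a_i$ is a crossing, $|a_i|$ is the number of up cusps minus the number of down cusps traversed by a path along the front from the understrand of $a_i$ to its overstrand. The differential has degree $-1$, satisfies $\partial(xy)=(\partial x)y+(-1)^{|x|}x\,\partial y$ and $\partial t^{\pm1}=0$, and $\partial a_i$ is the signed count of immersed disks (up to reparametrization) in the resolution with boundary on the diagram and convex corners at crossings, having exactly one positive corner, at $a_i$, and all other corners negative; at each crossing of the resolution the left and right quadrants are positive and the top and bottom quadrants are negative. Each disk contributes the word of its negative corners read counterclockwise along the boundary starting from the positive corner, with a letter $t$ or $t^{-1}$ inserted at each passage through the base point (according to whether the boundary traverses the base point along or against the orientation), with sign $(-1)$ to the number of corners at even-degree crossings occupying the bottom quadrant. Up to stable tame isomorphism $(\mathcal{A}_\Lambda,\partial)$ is a Legendrian isotopy invariant. Augmentations and linearization. For a unital commutative ring $R$ (in degree $0$ with zero differential), an $R$-valued augmentation is a graded unital ring homomorphism $\epsilon\colon\mathcal{A}_\Lambda\to R$ with $\epsilon\circ\partial=0$ and $\epsilon(a)=0$ for all $a$ of nonzero degree. Let $V$ be the free graded $R$-module on $a_1,\dots,a_m$. Let $\phi^\epsilon$ be the substitution $t^{\pm 1}\mapsto \epsilon(t)^{\pm 1}$, $a_i\mapsto s a_i+\epsilon(a_i)$ with $s$ a central formal parameter, and set $\partial^\epsilon a_i=\frac{d}{ds}\big|_{s=0}\phi^\epsilon(\partial a_i)\in V$. Then $(\partial^\epsilon)^2=0$, and $\mathrm{LCH}_*^\epsilon(\Lambda;R)=H_*(V,\partial^\epsilon)$;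 write $\mathrm{LCH}_*^\epsilon(\Lambda)$ when $R=\mathbb{Z}$. *)

(* Defs.v *)
From HB Require Import structures.
From mathcomp Require Import all_boot all_order all_algebra.
From mathcomp Require Import finmap boolp.
From mathcomp Require Import monalg.

Set Implicit Arguments.
Unset Strict Implicit.
Unset Printing Implicit Defensive.

Import GRing.Theory.
Local Open Scope ring_scope.

(* Plat diagrams.  A word of events is read from left to right; event number j
   takes place on the vertical wall number j, and the open slab between walls
   j - 1 and j carries [width w j] strands, numbered 0, 1, ... from bottom to
   top.  [LCusp k] creates the strands k and k + 1; [Cross k] crosses the
   strands k and k + 1.  On the last wall, number [size w], the strands 2i and
   2i + 1 are joined for all i.
   Such a word denotes a simple front (the joins are the right cusps) as well
   as the resolution of a simple front (the joins are smooth arcs). *)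
Inductive event := LCusp of nat | Cross of nat.

Definition spot (e : event) : nat := match e with LCusp k | Cross k => k end.
Definition is_cross (e : event) : bool := if e is Cross _ then true else false.

Definition bump2 (k h : nat) : nat := if (h < k)%N then h else h.+2.
Definition unbump2 (k h : nat) : nat := if (h < k)%N then h else h.-2.
Definition swap (k h : nat) : nat :=
  if h == k then k.+1 else if h == k.+1 then k else h.

Section Plat.

Variable w : seq event.

Definition ev (j : nat) : event := nth (Cross 0) w j.

Definition width (j : nat) : nat := (count (predC is_cross) (take j w)).*2.

Definition wf_plat : Prop :=
  forall j, (j < size w)%N ->
    match ev j with
    | LCusp k => (k <= width j)%N
    | Cross k => (k.+1 < width j)%N
    end.

(* The directed piece (r, (j, h)) is strand h of slab j, traversed to the right
   if r is true and to the left otherwise; [step] is the next directed piece. *)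
Definition dstrand : Type := bool * (nat * nat).

Definition step (d : dstrand) : dstrand :=
  let: (r, (j, h)) := d in
  if r then
    if (j < size w)%N then
      match ev j with
      | LCusp k => (true, (j.+1, bump2 k h))
      | Cross k => (true, (j.+1, swap k h))
      end
    else (false, (j, if odd h then h.-1 else h.+1))
  else
    match ev j.-1 with
    | LCusp k =>
        if h == k then (true, (j, k.+1))
        else if h == k.+1 then (true, (j, k))
        else (false, (j.-1, unbump2 k h))
    | Cross k => (false, (j.-1, swap k h))
    end.

(* Contribution to #(up cusps) - #(down cusps) of the passage from d to its
   successor; the direction changes exactly at cusps. *)
Definition cusp_sign (d : dstrand) : int :=
  if d.1 == (step d).1 then 0
  else if (d.2.2 < (step d).2.2)%N then 1 else -1.

Definition walk (d : dstrand) : seq dstrand :=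
  traject step d (\sum_(j < (size w).+1) width j)%N.

Definition origin : dstrand := (true, (1, 0))%N.

Definition is_knot : Prop :=
  [/\ wf_plat, (0 < size w)%N &
    forall j h, (j <= size w)%N -> (h < width j)%N ->
      exists n r, iter n step origin = (r, (j, h))].

(* #(up cusps) - #(down cusps) along the whole knot; this is, up to sign, twice
   the rotation number. *)
Definition cusp_total : int := \sum_(d <- walk origin) cusp_sign d.

(* At a crossing of the strands k and k + 1 on wall j, the understrand goes from
   (j, k) to (j + 1, k + 1) and the overstrand, of lower slope, from (j, k + 1)
   to (j + 1, k).  The path leaves along the understrand to the right and stops
   when it first enters the crossing along the overstrand. *)
Definition front_degree (j : nat) : int :=
  let k := spot (ev j) in
  let path := walk (true, (j.+1, k.+1)) in
  let stop (d : dstrand) := (d == (true, (j, k.+1))) || (d == (false, (j.+1, k))) in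
  \sum_(d <- take (find stop path) path) cusp_sign d.

(* The plane, cut along the diagram and along the walls, as a cell complex.
   In slab j the gap g lies between the strands g - 1 and g, so that
   gaps 0 and [width j] are outside the diagram.  Points and segments of wall j
   are numbered as the strands and gaps of slab j + 1 (of slab j for the last
   wall), two strands which meet on the wall being represented by the lower. *)
Inductive cell :=
  | Vert of nat & nat
  | Strand of nat & nat
  | Wall of nat & nat
  | Face of nat & nat.

Definition cell_code (x : cell) : (nat * nat + nat * nat) + (nat * nat + nat * nat) :=
  match x with
  | Vert j v => inl (inl (j, v))
  | Strand j h => inl (inr (j, h))
  | Wall j g => inr (inl (j, g))
  | Face j g => inr (inr (j, g))
  end.

Definition cell_decode (s : (nat * nat + nat * nat) + (nat * nat + nat * nat)) : cell :=
  match s with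
  | inl (inl (j, v)) => Vert j v
  | inl (inr (j, h)) => Strand j h
  | inr (inl (j, g)) => Wall j g
  | inr (inr (j, g)) => Face j g
  end.

Fact cell_codeK : cancel cell_code cell_decode.
Proof. by case. Qed.

HB.instance Definition _ := Equality.copy cell (can_type cell_codeK).

Definition is_vert (x : cell) : bool := if x is Vert _ _ then true else false.
Definition is_strand (x : cell) : bool := if x is Strand _ _ then true else false.
Definition is_wall (x : cell) : bool := if x is Wall _ _ then true else false.
Definition is_face (x : cell) : bool := if x is Face _ _ then true else false.
Definition is_edge (x : cell) : bool := is_strand x || is_wall x.

(* End points on wall j of strand h of slab j + 1, resp. of slab j. *)
Definition left_end (j h : nat) : nat :=
  let k := spot (ev j) in if h == k.+1 then k else h.
Definition right_end (j h : nat) : nat :=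
  if (j < size w)%N then
    match ev j with
    | LCusp k => bump2 k h
    | Cross k => if h == k.+1 then k else h
    end
  else h./2.*2.

(* Gap of slab j to the left of the segment g of wall j. *)
Definition left_gap (j g : nat) : nat :=
  match ev j with
  | LCusp k => if (g <= k)%N then g else g.-2
  | Cross _ => g
  end.

Definition valid_cell (x : cell) : bool :=
  match x with
  | Vert j v =>
      if (j < size w)%N then (v < width j.+1)%N && (v != (spot (ev j)).+1)
      else [&& j == size w, (v < width j)%N & ~~ odd v]
  | Strand j h => (j <= size w)%N && (h < width j)%N
  | Wall j g => [&& (j < size w)%N, (g <= width j.+1)%N & g != (spot (ev j)).+1]
  | Face j g => (j <= size w)%N && (g <= width j)%N
  end.

(* [incident x y]: the cell x lies in the closure of the cell y of larger
   dimension. *)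
Definition incident (x y : cell) : bool :=
  match x, y with
  | Vert j v, Strand i h =>
      [&& i == j.+1, (j < size w)%N & left_end j h == v]
      || (i == j) && (right_end j h == v)
  | Vert j v, Wall i g =>
      (i == j) && ((0 < g)%N && (left_end j g.-1 == v) || (left_end j g == v))
  | Vert j v, Face i g =>
      [&& i == j.+1, (j < size w)%N &
          (0 < g)%N && (left_end j g.-1 == v) || (left_end j g == v)]
      || (i == j) &&
         [|| (0 < g)%N && (right_end j g.-1 == v),
             right_end j g == v |
             [&& (j < size w)%N, ~~ is_cross (ev j),
                 g == spot (ev j) & v == spot (ev j)]]
  | Strand j h, Face i g => (i == j) && ((g == h) || (g == h.+1))
  | Wall j g, Face i f =>
      (i == j.+1) && (f == g) || (i == j) && (f == left_gap j g)
  | _, _ => false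
  end.

(* False on the cells of the unbounded region which are met by [width] or by
   the right end of the diagram; the other cells of the unbounded region are
   reached from these across walls. *)
Definition bounded_face (x : cell) : bool :=
  if x is Face j g then
    [&& (0 < g)%N, (g < width j)%N & (j < size w)%N || odd g]
  else true.

Definition at_crossing (x : cell) : bool :=
  if x is Vert j v then
    [&& (j < size w)%N, is_cross (ev j) & v == spot (ev j)]
  else false.

Inductive quadrant := QLeft | QRight | QTop | QBottom.

(* Faces around the crossing x in a given quadrant. *)
Definition quadrant_faces (x : cell) (q : quadrant) : seq cell :=
  if x is Vert j k then
    match q with
    | QLeft => [:: Face j k.+1]
    | QRight => [:: Face j.+1 k.+1]
    | QTop => [:: Face j k.+2; Face j.+1 k.+2]
    | QBottom => [:: Face j k; Face j.+1 k]
    end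
  else [::].

(* Faces around the vertex x on either side of a branch of the diagram through
   x: four sides at a crossing, two at any other vertex. *)
Definition sides (x : cell) : seq (seq cell) :=
  if x is Vert j v then
    let Q := quadrant_faces x in
    if at_crossing x then
      [:: Q QTop ++ Q QRight; Q QLeft ++ Q QBottom;
          Q QTop ++ Q QLeft; Q QRight ++ Q QBottom]
    else if (j < size w)%N then
      match ev j with
      | LCusp k =>
          if v == k then
            [:: [:: Face j.+1 k.+1];
                [:: Face j k; Face j.+1 k; Face j.+1 k.+2]]
          else let h := unbump2 k v in
            [:: [:: Face j h.+1; Face j.+1 v.+1]; [:: Face j h; Face j.+1 v]]
      | Cross _ =>
          [:: [:: Face j v.+1; Face j.+1 v.+1]; [:: Face j v; Face j.+1 v]]
      end
    else [:: [:: Face j v.+1]; [:: Face j v; Face j v.+2]]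
  else [::].

(* A candidate disk: an abstract finite cell complex with its incidence
   relation, a map [dlab] to the cells of the plane, a list of edges and a
   vertex. *)
Record disk_data := DiskData {
  dsize : nat;
  dinc : rel 'I_dsize;
  dlab : 'I_dsize -> cell;
  dbound : seq 'I_dsize;
  dpos : 'I_dsize
}.

Definition dcell (D : disk_data) : finType := 'I_(dsize D).

Definition star (D : disk_data) (c : dcell D) : seq cell :=
  [seq dlab d | d <- enum (dcell D) & dinc c d && is_face (dlab d)].

Definition corner (D : disk_data) (q : quadrant) (c : dcell D) : bool :=
  at_crossing (dlab c) && perm_eq (star c) (quadrant_faces (dlab c) q).

Definition positive_corner (D : disk_data) (c : dcell D) : bool :=
  corner QLeft c || corner QRight c.
Definition negative_corner (D : disk_data) (c : dcell D) : bool :=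
  corner QTop c || corner QBottom c.

Definition full_star (D : disk_data) (c : dcell D) : Prop :=
  forall x, valid_cell x -> is_face x -> incident (dlab c) x -> x \in star c.

Definition boundary_edge (D : disk_data) (e : dcell D) : bool :=
  is_strand (dlab e) && (size (star e) == 1)%N.

(* A boundary edge is traversed with the disk on its left, hence to the right
   exactly when the disk lies above it. *)
Definition rightward (D : disk_data) (e : dcell D) : bool :=
  if dlab e is Strand j h then Face j h.+1 \in star e else false.

(* The end points of an edge of slab j lie on wall j - 1 (left) and wall j
   (right). *)
Definition end_point (D : disk_data) (right : bool) (e c : dcell D) : bool :=
  dinc c e &&
  match dlab e, dlab c with
  | Strand j _, Vert i _ => if right then i == j else i.+1 == j
  | _, _ => false
  end.
Definition source (D : disk_data) (e c : dcell D) : bool :=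
  end_point (~~ rightward e) e c.
Definition target (D : disk_data) (e c : dcell D) : bool :=
  end_point (rightward e) e c.

Definition consecutive (D : disk_data) : rel (dcell D) :=
  [rel e e' | [exists c, target e c && source e' c]].

(* Immersed disks with convex corners and one positive corner, described by
   the pull-back of the cell structure of the plane: [dlab] maps each closed
   cell isomorphically, and is injective on the open star of each cell.
   The boundary lies on the diagram, and near a vertex the disk is everything,
   one side of a branch of the diagram, or one quadrant of a crossing.
   A connected compact surface with nonempty boundary and Euler characteristic
   1 is a disk.  [dbound] is the boundary, traversed counterclockwise from the
   positive corner [dpos]. *)
Record immersed_disk (D : disk_data) : Prop := ImmersedDisk {
  disk_valid : forall c : dcell D, valid_cell (dlab c) /\ bounded_face (dlab c);
  disk_incident : forall c d : dcell D, dinc c d -> incident (dlab c) (dlab d);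
  disk_trans : transitive (@dinc D);
  disk_closed_cell : forall (d : dcell D) x, valid_cell x -> incident x (dlab d) ->
    exists! c, dinc c d /\ dlab c = x;
  disk_immersed : forall c d d' : dcell D,
    dinc c d -> dinc c d' -> dlab d = dlab d' -> d = d';
  disk_pure : forall c : dcell D, ~~ is_face (dlab c) ->
    exists2 d, dinc c d & is_face (dlab d);
  disk_wall : forall c : dcell D, is_wall (dlab c) -> full_star c;
  disk_vert : forall c : dcell D, is_vert (dlab c) ->
    [\/ full_star c,
        (exists2 s, s \in sides (dlab c) & perm_eq (star c) s) |
        (exists q, corner q c)];
  disk_connected : forall c d : dcell D,
    connect [rel x y | dinc x y || dinc y x] c d;
  disk_euler : (#|[pred c : dcell D | is_vert (dlab c)]|
                + #|[pred c : dcell D | is_face (dlab c)]|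
              = #|[pred c : dcell D | is_edge (dlab c)]| + 1)%N;
  disk_positive : forall c : dcell D, positive_corner c = (c == dpos D);
  disk_bound : dbound D =i [pred e | boundary_edge e] /\ uniq (dbound D);
  disk_cycle : exists e s, [/\ dbound D = e :: s, source e (dpos D),
    path (@consecutive D) e s & target (last e s) (dpos D)]
}.

Definition disk_iso (D D' : disk_data) : Prop :=
  exists f : dcell D -> dcell D',
    [/\ bijective f, forall c, dlab (f c) = dlab c &
        forall c d, dinc (f c) (f d) = dinc c d].

(* The members of the list are the immersed disks with positive corner on wall
   j, up to reparametrization and without repetition. *)
Definition all_disks (j : nat) (l : seq disk_data) : Prop :=
  let disk_at D := immersed_disk D /\ exists v, dlab (dpos D) = Vert j v in
  [/\ (forall i D, onth l i = Some D -> disk_at D),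
      (forall i i' D D', onth l i = Some D -> onth l i' = Some D' ->
         disk_iso D D' -> i = i') &
      forall D, disk_at D -> exists i D',
        onth l i = Some D' /\ disk_iso D D'].

End Plat.

(* The resolution: one crossing is added to the left of each right cusp. *)
Definition resolution (w : seq event) : seq event :=
  w ++ [seq Cross i.*2 | i <- iota 0 (width w (size w))./2].

(* Homology of U -> V -> W at V. *)
Section Homology.

Variables (U V W : zmodType) (f : {additive U -> V}) (g : {additive V -> W}).

Definition cycle_pred : {pred V} := [pred v | g v == 0].

Fact cycle_pred_closed : zmod_closed cycle_pred.
Proof.
split=> [|x y]; rewrite !inE ?raddf0 // => /eqP gx /eqP gy.
by rewrite raddfB gx gy subr0.
Qed.

HB.instance Definition _ := GRing.isZmodClosed.Build V cycle_pred cycle_pred_closed.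

Record cycle := Cycle { cycle_val : V; _ : cycle_val \in cycle_pred }.

HB.instance Definition _ := [isSub for cycle_val].
HB.instance Definition _ := [Choice of cycle by <:].
HB.instance Definition _ := [SubChoice_isSubZmodule of cycle by <:].

Definition boundary_pred : {pred cycle} :=
  [pred c | `[< exists u, f u = cycle_val c >]].

Fact boundary_pred_closed : zmod_closed boundary_pred.
Proof.
split=> [|x y]; rewrite !inE.
  by apply/asboolP; exists 0; rewrite raddf0.
move=> /asboolP[u fu] /asboolP[v fv]; apply/asboolP; exists (u - v).
by rewrite raddfB fu fv.
Qed.

HB.instance Definition _ :=
  GRing.isZmodClosed.Build cycle boundary_pred boundary_pred_closed.

Definition homology : zmodType := Quotient.quot boundary_pred.

End Homology.

(* For 1 < n, 'Z_n is the cyclic group of order n. *)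
Definition has_cyclic_summand (n : nat) (H : zmodType) : Prop :=
  exists (K : zmodType) (f : {additive H -> ('Z_n * K)%type}), bijective f.

Section DGA.

Variable w : seq event.

(* Reeb chords: crossings of the resolution, indexed by their walls. *)
Definition chord : Type :=
  {j : 'I_(size (resolution w)) | is_cross (ev (resolution w) j)}.
HB.instance Definition _ := Finite.on chord.

Definition wall_of (a : chord) : nat := val (val a).

Definition wall_degree (j : nat) : int :=
  if (j < size w)%N then front_degree w j else 1.
Definition degree (a : chord) : int := wall_degree (wall_of a).

(* Letters: inr true stands for t and inr false for t^-1. *)
Definition letter : Type := (chord + bool)%type.
HB.instance Definition _ := Finite.on letter.

Definition letter_degree (l : letter) : int :=
  if l is inl a then degree a else 0.

(* The free algebra on the Reeb chords and on two further letters; the algebra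
   of the knot is its quotient by the relations t t^-1 = t^-1 t = 1. *)
Definition free_alg : Type := {malg int[{fmonom letter}]}.
HB.instance Definition _ := GRing.NzRing.on free_alg.

Definition gen (l : letter) : free_alg := << fmu l >>.
Definition word (u : seq letter) : free_alg := \prod_(l <- u) gen l.

Section Disks.

(* The base point lies on the strand b.2 of slab b.1 of the resolution; o is
   true if the orientation of the knot at the base point is to the right. *)
Variables (b : nat * nat) (o : bool).

Definition disk_letters (D : disk_data) (e : dcell D) : seq letter :=
  (if dlab e == Strand b.1 b.2 then [:: inr (rightward e == o)] else [::]) ++
  [seq inl a | a <- enum {: chord} &
    [exists c, [&& target e c, negative_corner (resolution w) c &
                   dlab c == Vert (wall_of a) (spot (ev (resolution w) (wall_of a)))]]].

Definition disk_word (D : disk_data) : seq letter :=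
  flatten [seq disk_letters e | e <- dbound D].

Definition even_at (x : cell) : bool :=
  if x is Vert j _ then ~~ odd `|wall_degree j|%N else false.

Definition disk_sign (D : disk_data) : int :=
  (-1) ^+ #|[pred c : dcell D | corner (resolution w) QBottom c && even_at (dlab c)]|.

Definition disk_sum (l : seq disk_data) : free_alg :=
  \sum_(D <- l) word (disk_word D) *~ disk_sign D.

End Disks.

Section Differential.

(* Values of the differential on the Reeb chords. *)
Variable d : chord -> free_alg.

Definition diff_letter (l : letter) : free_alg := if l is inl a then d a else 0.

Fixpoint diff_word (u : seq letter) : free_alg :=
  if u is l :: v then
    diff_letter l * word v
    + (-1) ^+ `|letter_degree l|%N * (gen l * diff_word v)
  else 0.

(* The derivation extending d, with the sign rule, and vanishing at t, t^-1. *)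
Definition diff (x : free_alg) : free_alg :=
  \sum_(u <- msupp x) diff_word u *~ x@_u.

Definition augmentation (eps : {rmorphism free_alg -> int}) : Prop :=
  [/\ eps (gen (inr true) * gen (inr false)) = 1,
      eps (gen (inr false) * gen (inr true)) = 1,
      forall x, eps (diff x) = 0 &
      forall a, degree a <> 0 -> eps (gen (inl a)) = 0].

Section Linearization.

Variable eps : {rmorphism free_alg -> int}.

(* The formal parameter s is the polynomial variable. *)
Definition subst_letter (l : letter) : {poly free_alg} :=
  if l is inl a then 'X * (gen l)%:P + (eps (gen l))%:~R else (eps (gen l))%:~R.

Definition subst_eps (x : free_alg) : {poly free_alg} :=
  \sum_(u <- msupp x) (\prod_(l <- (u : seq letter)) subst_letter l) *~ x@_u.

Definition lin_diff (a : chord) : free_alg := ((subst_eps (d a))^`()).[0].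

Definition chain (k : int) : zmodType := {ffun {a : chord | degree a == k} -> int}.

(* Component from degree k to degree l of the linearized differential. *)
Definition lin_boundary (k l : int) (v : chain k) : chain l :=
  [ffun b => \sum_a v a * (lin_diff (val a))@_(fmu (inl (val b) : letter))].

Fact lin_boundary_additive k l : zmod_morphism (@lin_boundary k l).
Proof.
move=> u v; apply/ffunP=> b; rewrite !ffunE -sumrB.
by apply: eq_bigr => a _; rewrite !ffunE mulrBl.
Qed.

HB.instance Definition _ k l := GRing.isZmodMorphism.Build
  (chain k) (chain l) (@lin_boundary k l) (@lin_boundary_additive k l).

Definition LCH (k : int) : zmodType :=
  homology (@lin_boundary (k + 1) k) (@lin_boundary k (k - 1)).

End Linearization.

End Differential.

End DGA.

(* Main.v *)
(* Move to the right inside a disk of the resolution of a simple front: one can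
   only stop at the left quadrant of a crossing, which is then the positive
   corner, or in the loop of a right cusp, and then the disk is this loop.  Hence
   the disk meets each slab in a single interval of gaps, it is embedded in the
   plane, and it is determined by its set of faces.  These sets are enumerated by
   sweeping the diagram from right to left.

   For the knot below, with chords numbered by their walls, 6 is the only chord of
   degree -1, there is none of degree -2, and the only differentials of chords of
   degree 0 are d 7 = - 6 4 and d 9 = 3 6.  Sending 3 to -n, 8 to n - 1, 10 and t
   to -1 and the other chords to 0 is an augmentation, whose linearized
   differential sends 9 to -n 6 and vanishes on the other chords of degree 0, so
   that the homology in degree -1 is Z/n. *)
Require Import Defs.
From HB Require Import structures.
From mathcomp Require Import all_boot all_order all_algebra.
From mathcomp Require Import finmap boolp monalg zify.

Set Implicit Arguments.
Unset Strict Implicit.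
Unset Printing Implicit Defensive.

Import GRing.Theory.
Local Open Scope ring_scope.

(** * Immersed disks are embedded *)

Section Geometry.

Local Open Scope nat_scope.

(** [all_disks] quantifies over abstract complexes of arbitrary size, so the disks cannot be found
    by a direct search. The way out is injectivity of [dlab]: a disk is then the subcomplex of the
    plane on its set of labels, a subset of a finite set, and its corners, boundary, word and sign
    can be computed from the labels. The obstacle is that an immersed disk could a priori have
    several sheets over one slab. The sheets are followed to the right, where each of them leads to
    the positive corner, and the uniqueness of that corner makes them one. What this argument needs
    from the diagram is a list of Boolean conditions on its finitely many cells and the form of its
    last walls; it is carried out for any word of events with these properties, which are then
    evaluated for the knot. In the enumeration, every disk is found because the sweep imposes only
    necessary conditions, while evaluation confirms that each set found is a disk. *)

Definition slab (x : cell) : nat := if x is Face j _ then j else 0.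
Definition gap (x : cell) : nat := if x is Face _ g then g else 0.

Lemma common_edge g h h' : (h = g.+1 \/ g = h.+1) ->
  ((g == h') || (g == h'.+1)) && ((h == h') || (h == h'.+1)) -> h' = minn g h.
Proof. lia. Qed.

Lemma sub_eq0 m n : m <= n -> n - m = 0 -> m = n.
Proof. lia. Qed.

Section Cells.

Variable W : seq event.

Definition positions : seq (nat * nat) :=
  [seq (j, g) | j <- iota 0 (size W).+1, g <- iota 0 (width W (size W)).+1].

Definition cells : seq cell :=
  [seq x <- flatten [seq [:: Vert p.1 p.2; Strand p.1 p.2; Wall p.1 p.2; Face p.1 p.2]
                    | p <- positions] | valid_cell W x].

Lemma width_max j : width W j <= width W (size W).
Proof.
rewrite /width take_size leq_double -[X in _ <= count _ X](cat_take_drop j W).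
by rewrite count_cat leq_addr.
Qed.

Lemma mem_cells x : (x \in cells) = valid_cell W x.
Proof.
rewrite mem_filter andb_idr // => vx.
suff: exists p, [/\ p.1 <= size W, p.2 <= width W (size W) &
    x \in [:: Vert p.1 p.2; Strand p.1 p.2; Wall p.1 p.2; Face p.1 p.2]].
  case=> [[j g] [lej leg xin]]; apply/flatten_mapP; exists (j, g) => //.
  by apply/allpairsP; exists (j, g); split; rewrite // mem_iota ltnS.
have wm j k : k <= width W j -> k <= width W (size W) by move/leq_trans; apply; apply: width_max.
case: x vx => j g vx; exists (j, g); rewrite /= !inE eqxx ?orbT; split=> //; move: vx => /=.
- by case: ltnP => [/ltnW //|_ /andP[/eqP->]].
- by case: ltnP => [_ /andP[/ltnW+ _]|_ /and3P[/eqP-> /ltnW //]]; apply: wm.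
- by case/andP.
- by case/andP=> _ /ltnW; apply: wm.
- by case/and3P=> /ltnW.
- by case/and3P=> _ + _; apply: wm.
- by case/andP.
- by case/andP=> _; apply: wm.
Qed.

Definition faces_at (x : cell) : seq cell := [seq f <- cells | is_face f & incident W x f].

(** Stars that leave the region allowed by [bounded_face] cannot occur in a disk, and the conditions
    below are not asked of them. *)
Definition stars (x : cell) : seq (seq cell) :=
  [seq s <- faces_at x :: sides W x ++
    (if at_crossing W x then
       [seq quadrant_faces x q | q <- [:: QLeft; QRight; QTop; QBottom]] else [::])
  | all (bounded_face W) s].

(* These local conditions force a disk which is swept from right to left to
   occupy consecutive gaps of each slab. *)
Definition star_ok (i v : nat) (s : seq cell) : bool :=
  let l := [seq gap f | f <- s & slab f == i] in
  let r := [seq f <- s | slab f == i.+1] in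
  [&& all (fun g => all (fun g' => (g < g') ==> (g.+1 \in l)) l) l,
      (1 < size r) ==> (l != [::]) &
      at_crossing W (Vert i v) && (v.+1 \in l) ==>
        (s == [:: Face i v.+1]) || has (predC1 v.+1) l].

(** In order: admissible stars behave well under the sweep; inside one slab, two faces around the
    vertex are separated by strands ending at it; a star wholly to the left of the wall and one
    wholly to the right can only be the left and right quadrants of a crossing. The last clause
    deals with two vertices of a disk that have the same label and see opposite sides of the
    wall. *)
Definition vertex_ok (x : cell) : bool :=
  if x is Vert i v then
    [&& all (star_ok i v) (stars x),
        all (fun f => all (fun f' => (slab f == slab f') && (gap f < gap f') ==>
           let y := Strand (slab f) (gap f) in
           let z := Face (slab f) (gap f).+1 in
           [&& valid_cell W y, incident W x y, valid_cell W z & incident W x z])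
           (faces_at x)) (faces_at x) &
        all (fun s => all (fun s' =>
           all (fun f => slab f == i) s && all (fun f => slab f == i.+1) s' ==>
             [&& at_crossing W x, s == quadrant_faces x QLeft &
                 s' == quadrant_faces x QRight]) (stars x)) (stars x)]
  else true.

Definition wall_ok (x : cell) : bool :=
  if x is Wall i f then
    valid_cell W (Face i (left_gap W i f)) && ((0 < f) && (f < width W i.+1) ==>
      valid_cell W (Vert i (left_end W i f.-1)))
  else true.

(** On its left a face either opens, at a left cusp or as the right quadrant of a crossing, or has a
    wall segment. On its right, before the last wall, it either closes as the left quadrant of a
    crossing or continues across a wall segment. *)
Definition face_ok (x : cell) : bool :=
  if x is Face j g then
    bounded_face W x ==>
      ((0 < j) && ((g == (spot (ev W j.-1)).+1) || valid_cell W (Wall j.-1 g))) &&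
      ((j < size W) ==>
         (0 < g) && at_crossing W (Vert j g.-1) && valid_cell W (Vert j g.-1)
         || has (fun f => valid_cell W (Wall j f) && (left_gap W j f == g))
                (iota 0 (width W j.+1).+1))
  else true.

Definition strand_ok (x : cell) : bool :=
  if x is Strand j h then (0 < j) && valid_cell W (Vert j.-1 (left_end W j.-1 h)) else true.

Definition cell_ok (x : cell) : bool :=
  [&& vertex_ok x, wall_ok x, face_ok x & strand_ok x].

Definition locally_ok : bool := all cell_ok cells.

Section Disk.

Variable D : disk_data.
Hypothesis HD : immersed_disk W D.
Hypothesis Wok : locally_ok.

Implicit Types c d e x y : dcell D.

Lemma cell_in_closure (d : dcell D) (x : cell) : valid_cell W x -> incident W x (dlab d) ->
  exists2 c, dinc c d & dlab c = x.
Proof. by move=> vx ix; have [c [[cd cx] _]] := disk_closed_cell HD vx ix; exists c. Qed.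

Lemma cell_valid c : valid_cell W (dlab c).
Proof. by case: (disk_valid HD c). Qed.

Lemma cell_closure_inj (d c c' : dcell D) :
  dinc c d -> dinc c' d -> dlab c = dlab c' -> c = c'.
Proof.
move=> cd c'd cc'; have ix := disk_incident HD cd.
have [c0 [_ c0u]] := disk_closed_cell HD (cell_valid c) ix.
by rewrite -(c0u c) // -(c0u c').
Qed.

(** The closed cell of [d] contains a cell labelled [z], whose own closure contains a copy of [c];
    this copy is [c], because labels are injective on one closed cell. *)
Lemma cell_between (c d : dcell D) z : dinc c d -> valid_cell W z ->
  incident W (dlab c) z -> incident W z (dlab d) ->
  exists e, [/\ dlab e = z, dinc c e & dinc e d].
Proof.
move=> cd vz icz izd; have [e ed ez] := cell_in_closure vz izd.
have [c' c'e c'c] : exists2 c', dinc c' e & dlab c' = dlab c.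
  by apply: cell_in_closure; rewrite ?cell_valid ?ez.
have c'd := disk_trans HD c'e ed.
by exists e; split=> //; rewrite (cell_closure_inj cd c'd).
Qed.

Lemma mem_starP c (x : cell) :
  reflect (exists2 d, dinc c d & dlab d = x /\ is_face x) (x \in star c).
Proof.
apply: (iffP mapP) => [[d]|[d cd [<- fd]]].
  by rewrite mem_filter => /andP[/andP[cd fd] _] ->; exists d.
by exists d; rewrite // mem_filter cd fd mem_enum.
Qed.

Lemma starP c d : dinc c d -> is_face (dlab d) -> dlab d \in star c.
Proof. by move=> cd fd; apply/mem_starP; exists d. Qed.

Lemma star_allowed c : is_vert (dlab c) -> exists2 s, s \in stars (dlab c) & star c =i s.
Proof.
move=> vc; have bounded s : star c =i s -> all (bounded_face W) s.
  move=> ss; apply/allP=> x; rewrite -ss => /mem_starP[d _ [<- _]].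
  by case: (disk_valid HD d).
have [full|[s sin /perm_mem ps]|[q cq]] := disk_vert HD vc.
- have ss : star c =i faces_at (dlab c).
    move=> x; rewrite mem_filter mem_cells; apply/idP/idP=> [/mem_starP[d cd [<- ->]]|].
      by rewrite (disk_incident HD cd) cell_valid.
    by case/andP=> /andP[fx ix] vx; apply: full.
  by exists (faces_at (dlab c)) => //; rewrite mem_filter bounded // inE eqxx.
- by exists s => //; rewrite mem_filter bounded // inE mem_cat sin orbT.
- case/andP: cq => atc /perm_mem pq; exists (quadrant_faces (dlab c) q) => //.
  rewrite mem_filter bounded // atc.
  by case: q {pq}; rewrite !inE !mem_cat !inE eqxx ?orbT.
Qed.

Lemma face_bounded d : is_face (dlab d) -> [/\ 0 < gap (dlab d),
  gap (dlab d) < width W (slab (dlab d)), slab (dlab d) <= size W &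
  slab (dlab d) < size W \/ odd (gap (dlab d))].
Proof.
have [] := disk_valid HD d; case: (dlab d) => //= j g /andP[lej _] /and3P[g0 gw o] _.
by split=> //; case/orP: o; [left|right].
Qed.

Lemma faceE d : is_face (dlab d) -> dlab d = Face (slab (dlab d)) (gap (dlab d)).
Proof. by case: (dlab d). Qed.

(** * Vertical components of a disk over a slab *)

Definition vadj : rel (dcell D) :=
  [rel d d' | [exists e, [&& is_strand (dlab e), dinc e d & dinc e d']]].

Lemma vadj_sym : symmetric vadj.
Proof.
by move=> d d'; apply/existsP/existsP=> -[e /and3P[e1 e2 e3]]; exists e; apply/and3P.
Qed.

Lemma vconn_sym : connect_sym vadj.
Proof. exact: sym_connect_sym vadj_sym. Qed.

Lemma vadj_face d d' : vadj d d' ->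
  [/\ is_face (dlab d), is_face (dlab d'), slab (dlab d) = slab (dlab d') &
   exists2 h, exists2 e, dlab e = Strand (slab (dlab d)) h & dinc e d /\ dinc e d' &
     ((gap (dlab d) == h) || (gap (dlab d) == h.+1)) &&
     ((gap (dlab d') == h) || (gap (dlab d') == h.+1))].
Proof.
case/existsP=> e /and3P[se ed ed'].
have := disk_incident HD ed; have := disk_incident HD ed'.
case Ee: (dlab e) se => [//|j h|//|//] _.
case Ed: (dlab d) => [? ?|? ?|? ?|j1 g1] //=; case Ed': (dlab d') => [? ?|? ?|? ?|j2 g2] //=.
move=> /andP[/eqP-> b2] /andP[/eqP-> b1]; split=> //.
by exists h; rewrite ?b1 // ; exists e.
Qed.

Lemma vadj_gap d d' : vadj d d' -> d != d' ->
  gap (dlab d') = (gap (dlab d)).+1 \/ gap (dlab d) = (gap (dlab d')).+1.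
Proof.
case/vadj_face=> fd fd' sd [h [e Ee [ed ed']]] /andP[/orP[]/eqP g1 /orP[]/eqP g2];
  rewrite ?g1 ?g2; [|by left|by right|]; move=> /eqP[];
  by apply: (disk_immersed HD ed ed'); rewrite (faceE fd) (faceE fd') sd g1 g2.
Qed.

(** The strand shared with [d] is determined by the gaps, and the disk is immersed along it. *)
Lemma vadj_inj d x y : vadj d x -> vadj d y -> d != x -> d != y ->
  dlab x = dlab y -> x = y.
Proof.
move=> dx dy nx ny xy; have gx := vadj_gap dx nx; have gy := vadj_gap dy ny.
have [_ _ _ [h [e Ee [ed ex]]] hx] := vadj_face dx.
have [_ _ _ [h' [e' Ee' [ed' ey]]] hy] := vadj_face dy.
have hh : h = h' by rewrite (common_edge gx hx) (common_edge gy hy) xy.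
have ee : e = e' by apply: (cell_closure_inj ed ed'); rewrite Ee Ee' hh.
by rewrite -ee in ey; apply: (disk_immersed HD ex ey).
Qed.

(* A simple vertical path cannot turn back. *)
Lemma vpath_mono b p d x : path vadj d (x :: p) -> uniq (d :: x :: p) ->
  (if b then gap (dlab x) = (gap (dlab d)).+1 else gap (dlab d) = (gap (dlab x)).+1) ->
  if b then gap (dlab x) <= gap (dlab (last x p)) else
            gap (dlab (last x p)) <= gap (dlab x).
Proof.
elim: p d x => [|y p IHp] d x; first by case: b => /=.
move=> /= /and3P[dx xy yp]; rewrite !inE !negb_or -!andbA.
move=> /and5P[ndx ndy ndp nxy /andP[nxp /andP[nyp up]]] gdx.
have [_ _ sdx _] := vadj_face dx; have [_ _ sxy _] := vadj_face xy.
have [fd fx _ _] := vadj_face dx; have [_ fy _ _] := vadj_face xy.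
have gxy := vadj_gap xy nxy.
have ngg : gap (dlab y) != gap (dlab d).
  apply/eqP=> gg; case/eqP: ndy; apply: (@vadj_inj x) => //.
  - by rewrite vadj_sym.
  - by rewrite eq_sym.
  - by rewrite (faceE fd) (faceE fy) gg sdx sxy.
have pxy : path vadj x (y :: p) by rewrite /= xy.
have uxy : uniq [:: x, y & p] by rewrite /= inE negb_or nxy nxp nyp up.
have /= H := IHp x y pxy uxy; move: gxy gdx ngg H.
move: (gap (dlab x)) (gap (dlab y)) (gap (dlab d)) (gap (dlab (last y p))) => gx gy gd gl.
clear; case: b; lia.
Qed.

Lemma vconn_face d d' : connect vadj d d' -> is_face (dlab d) ->
  is_face (dlab d') /\ slab (dlab d') = slab (dlab d).
Proof.
case/connectP=> p pp ->; elim: p d pp => //= x p IHp d /andP[dx xp] fd.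
have [_ fx sx _] := vadj_face dx; have [? ->] := IHp _ xp fx; by split.
Qed.

Lemma vconn_step d d' : connect vadj d d' -> gap (dlab d) < gap (dlab d') ->
  exists x, [/\ vadj d x, gap (dlab x) = (gap (dlab d)).+1 & connect vadj x d'].
Proof.
case/connectP=> p pp ->; case/shortenP: pp => -[_ _ _|x p' pp up _]; first by rewrite ltnn.
move=> lt; have /= /andP[dx xp] := pp; exists x.
have ndx : d != x by case/andP: up; rewrite inE negb_or => /andP[].
split=> //; last by apply/connectP; exists p'.
case: (vadj_gap dx ndx) => // gx.
by have /= := @vpath_mono false _ _ _ pp up gx; move: lt; rewrite /= gx; lia.
Qed.

(** A simple vertical path changes the gap monotonically, so it cannot come back to the gap where it
    started: a vertical component is an embedded column. *)
Lemma vconn_inj d d' : connect vadj d d' -> dlab d = dlab d' -> d = d'.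
Proof.
case/connectP=> p pp ->; case/shortenP: pp => -[//|x p' pp up _] /= lab.
have /= /andP[dx xp] := pp.
have ndx : d != x by case/andP: up; rewrite inE negb_or => /andP[].
case: (vadj_gap dx ndx) => gx.
  by have := @vpath_mono true _ _ _ pp up gx; rewrite -lab gx ltnn.
by have := @vpath_mono false _ _ _ pp up gx; rewrite -lab gx ltnn.
Qed.

Lemma cell_okP c : cell_ok (dlab c).
Proof. by apply: (allP Wok); rewrite mem_cells cell_valid. Qed.

Lemma vertexP c : is_vert (dlab c) -> vertex_ok (dlab c).
Proof. by move=> _; case/and4P: (cell_okP c). Qed.

Lemma face_at c d : dinc c d -> is_face (dlab d) -> dlab d \in faces_at (dlab c).
Proof. by move=> cd fd; rewrite mem_filter fd (disk_incident HD cd) mem_cells cell_valid. Qed.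

Lemma strand_above c d f : is_vert (dlab c) -> dinc c d -> is_face (dlab d) ->
  f \in faces_at (dlab c) -> slab f = slab (dlab d) -> gap (dlab d) < gap f ->
  let z := Face (slab (dlab d)) (gap (dlab d)).+1 in
  exists e, [/\ dlab e = Strand (slab (dlab d)) (gap (dlab d)), dinc c e, dinc e d,
     valid_cell W z & incident W (dlab c) z].
Proof.
move=> vc cd fd fin ss lt; have := vertexP vc; case Ec: (dlab c) vc fin => [i v|//|//|//] _ fin.
case/and3P=> _ /allP/(_ _ (_ : dlab d \in _))/allP + _.
move=> /(_ _ _ fin); rewrite -{1}Ec face_at // ss eqxx lt => /(_ isT) /and4P[vy iy vz iz].
have [e [Ee ce ed]] : exists e, [/\ dlab e = Strand (slab (dlab d)) (gap (dlab d)),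
    dinc c e & dinc e d].
  by apply: cell_between => //; rewrite ?Ec // [X in incident _ _ X](faceE fd) /= !eqxx.
by exists e.
Qed.

Lemma vertex_glue c d d' : is_vert (dlab c) -> dinc c d -> dinc c d' ->
  is_face (dlab d) -> is_face (dlab d') -> slab (dlab d) = slab (dlab d') ->
  gap (dlab d') = (gap (dlab d)).+1 -> vadj d d'.
Proof.
move=> vc cd cd' fd fd' ss gg.
have lt : gap (dlab d) < gap (dlab d') by rewrite gg.
have [e [Ee ce ed vz iz]] := strand_above vc cd fd (face_at cd' fd') (esym ss) lt.
have [e' [Ee' ce' ed']] : exists e, [/\ dlab e = Strand (slab (dlab d)) (gap (dlab d)),
    dinc c e & dinc e d'].
  apply: cell_between => //; rewrite -?Ee ?cell_valid ?(disk_incident HD ce) //.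
  by rewrite Ee [X in incident _ _ X](faceE fd') /= ss gg !eqxx orbT.
have ee : e = e' by apply: (disk_immersed HD ce ce'); rewrite Ee Ee'.
by apply/existsP; exists e; rewrite Ee ed ee ed'.
Qed.

(** The gaps of an admissible star to the left of its wall are consecutive, and faces in consecutive
    gaps at one vertex share a strand ending there. The proof climbs one gap at a time. *)
Lemma left_vconn i v c d d' : dlab c = Vert i v -> dinc c d -> dinc c d' ->
  is_face (dlab d) -> is_face (dlab d') -> slab (dlab d) = i -> slab (dlab d') = i ->
  connect vadj d d'.
Proof.
move=> Ec; have vc : is_vert (dlab c) by rewrite Ec.
wlog le : d d' / gap (dlab d) <= gap (dlab d').
  by move=> H cd cd' fd fd' sd sd'; case: (leqP (gap (dlab d)) (gap (dlab d'))) => [|/ltnW];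
    move/H => H'; [|rewrite vconn_sym]; apply: H'.
have [s sin ss] := star_allowed vc.
have := vertexP vc; rewrite Ec in sin *; case/and3P=> /allP/(_ _ sin)/and3P[/allP sok _ _] _ _.
have glaps x : dinc c x -> is_face (dlab x) -> slab (dlab x) = i ->
    gap (dlab x) \in [seq gap f | f <- s & slab f == i].
  by move=> cx fx sx; apply: map_f; rewrite mem_filter sx eqxx -ss starP.
move: {2}(_ - _) (erefl (gap (dlab d') - gap (dlab d))) => n.
elim: n d le => [|n IHn] d le nE cd cd' fd fd' sd sd'.
  rewrite (_ : d = d') ?connect0 //; apply: (disk_immersed HD cd cd').
  by rewrite (faceE fd) (faceE fd') sd sd' (sub_eq0 le nE).
have lt : gap (dlab d) < gap (dlab d') by rewrite -subn_gt0 nE.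
have /allP/(_ _ (glaps _ cd' fd' sd')) := sok _ (glaps _ cd fd sd).
rewrite lt => /mapP[f]; rewrite mem_filter -ss => /andP[/eqP sf /mem_starP[x cx [Ex fx]]] gf.
rewrite -Ex in fx sf gf.
have dx : vadj d x by apply: (vertex_glue vc) => //; rewrite ?sd ?sf.
apply: connect_trans (connect1 dx) _.
by apply: IHn; rewrite // -gf // subnS nE.
Qed.

(** The strands climbed from [d] to [d'] all end at the common point of the plane, so [c] stays
    incident to each face on the way up to [d'], whose closed cell contains only one such vertex. *)
Lemma vconn_vertex c c' d d' : connect vadj d d' -> is_vert (dlab c) -> dlab c = dlab c' ->
  dinc c d -> dinc c' d' -> is_face (dlab d) -> c = c'.
Proof.
wlog le : c c' d d' / gap (dlab d) <= gap (dlab d').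
  move=> H dd' vc cc' cd cd' fd; case: (leqP (gap (dlab d)) (gap (dlab d'))) => [|/ltnW] le.
    exact: (H c c' d d').
  symmetry; apply: (H c' c d' d) => //; [by rewrite vconn_sym|by rewrite -cc'|].
  by case: (vconn_face dd' fd).
move: {2}(_ - _) (erefl (gap (dlab d') - gap (dlab d))) => n.
elim: n c d le => [|n IHn] c d le nE dd' vc cc' cd cd' fd.
  have [fd' sd'] := vconn_face dd' fd.
  have E : d = d'.
    by apply: vconn_inj => //; rewrite (faceE fd) (faceE fd') sd'; congr Face; lia.
  by rewrite -E in cd'; apply: (cell_closure_inj cd cd').
have [fd' sd'] := vconn_face dd' fd.
have lt : gap (dlab d) < gap (dlab d') by rewrite -subn_gt0 nE.
have [x [dx gx xd']] := vconn_step dd' lt.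
have [_ fx sx [h [e0 Ee0 [e0d e0x]]] hh] := vadj_face dx.
have d'in : dlab d' \in faces_at (dlab c) by rewrite cc' face_at.
have [e [Ee ce ed _ _]] := strand_above vc cd fd d'in sd' lt.
have ee : e0 = e.
  by apply: (cell_closure_inj e0d ed); rewrite Ee0 Ee (common_edge (or_introl gx) hh) gx (minn_idPl (leqnSn _)).
apply: (IHn c x _ _ xd') => //; rewrite ?gx ?subnS ?nE //.
by apply: (disk_trans HD ce); rewrite -ee.
Qed.

Lemma wall_faces e i f : dlab e = Wall i f -> exists x y,
  [/\ dinc e x, dlab x = Face i (left_gap W i f), dinc e y & dlab y = Face i.+1 f].
Proof.
move=> Ee; have we : is_wall (dlab e) by rewrite Ee.
have full := disk_wall HD we; have ve := cell_valid e.
have /and4P[_ + _ _] := cell_okP e; rewrite Ee in ve * => /andP[vl _].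
have /mem_starP[x ex [Ex _]] : Face i (left_gap W i f) \in star e.
  by apply: full; rewrite ?Ee //= !eqxx orbT.
have /mem_starP[y ey [Ey _]] : Face i.+1 f \in star e.
  by apply: full; rewrite ?Ee /= ?eqxx //; case/and3P: ve => lti lef _; rewrite lti lef.
by exists x, y.
Qed.

(** * Passing from one slab to the next *)

Definition across x y : Prop :=
  exists i f, [/\ dlab y = Face i.+1 f, slab (dlab x) = i, is_face (dlab x) &
    exists e, [/\ dlab e = Wall i f, dinc e x & dinc e y]].

Lemma across_vert x y c i v : across x y -> dlab c = Vert i v ->
  slab (dlab y) = i.+1 -> dinc c y -> dinc c x.
Proof.
case=> i' [f [Ey sx fx [e [Ee ex ey]]]] Ec; rewrite Ey => -[ii] cy; rewrite ii in Ee Ey.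
have ve := cell_valid e; rewrite Ee in ve.
have icy := disk_incident HD cy; rewrite Ec Ey /= eqxx /= in icy.
have [e' [Ee' ce' e'y]] : exists e', [/\ dlab e' = Wall i f, dinc c e' & dinc e' y].
  apply: cell_between => //; rewrite ?Ec ?Ey /= ?eqxx //.
  by move: icy; rewrite (gtn_eqF (ltnSn i)) orbF => /andP[_ ->].
have ee : e' = e by apply: (cell_closure_inj e'y ey); rewrite Ee'.
by rewrite ee in ce'; apply: (disk_trans HD ce').
Qed.

Lemma across_exists_vert x y : across x y ->
  exists c v, [/\ dlab c = Vert (slab (dlab x)) v, dinc c x & dinc c y].
Proof.
move=> xy; have [i [f [Ey sx fx [e [Ee ex ey]]]]] := xy.
have fy : is_face (dlab y) by rewrite Ey.
have [f0 fw _ _] := face_bounded fy; rewrite Ey /= in f0 fw.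
have /and4P[_ + _ _] := cell_okP e; rewrite Ee /= f0 fw => /andP[_ vv].
have [c cy Ec] : exists2 c, dinc c y & dlab c = Vert i (left_end W i f.-1).
  apply: cell_in_closure => //; rewrite Ey /= eqxx f0 eqxx /=.
  by have := cell_valid e; rewrite Ee => /and3P[->].
exists c, (left_end W i f.-1); rewrite sx; split=> //.
by apply: (across_vert xy Ec) => //; rewrite Ey.
Qed.

(** Weaker than [across]: a face that opens at a crossing has no wall segment on its left, yet it
    may share a vertex with faces there. *)
Definition touch x y : Prop := exists i v c,
  [/\ dlab c = Vert i v, dinc c x & dinc c y] /\
  [/\ is_face (dlab x), is_face (dlab y), slab (dlab x) = i & slab (dlab y) = i.+1].

Lemma across_touch x y : across x y -> touch x y.
Proof.
move=> xy; have [c [v [Ec cx cy]]] := across_exists_vert xy.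
have [i [f [Ey sx fx _]]] := xy.
by exists i, v, c; rewrite -{1}sx Ey.
Qed.

(** Either [y] opens on its left wall, and then it has a single vertex on that side, or there is a
    face across its left wall segment, and this face contains all vertices on the left of [y]. Both
    cases end with [left_vconn]. *)
Lemma touch_vconn x x' y : touch x y -> touch x' y -> connect vadj x x'.
Proof.
move=> [i [v [c [[Ec cx cy] [fx fy sx sy]]]]] [i' [v' [c' [[Ec' c'x' c'y] [fx' _ sx' sy']]]]].
have ii : i' = i by move: sy'; rewrite sy => -[].
rewrite ii in Ec' sx'; clear sy'.
have := cell_okP y; case/and4P=> _ _ + _; rewrite (faceE fy) sy.
have [_ by_] := disk_valid HD y; rewrite (faceE fy) sy in by_.
rewrite /face_ok by_ => /andP[/= /orP[/eqP gy|vw] _].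
  have vE c0 v0 : dlab c0 = Vert i v0 -> dinc c0 y -> v0 = spot (ev W i).
    move=> Ec0 c0y; have := disk_incident HD c0y.
    rewrite Ec0 (faceE fy) sy gy /= eqxx /left_end eqxx (gtn_eqF (ltnSn i)) orbF.
    by rewrite if_same orbb => /andP[_ /andP[_ /eqP]].
  have cc : c = c'.
    by apply: (cell_closure_inj cy c'y); rewrite Ec Ec' (vE c v Ec cy) (vE c' v' Ec' c'y).
  by rewrite -cc in c'x'; apply: (left_vconn Ec).
have [e ey Ee] : exists2 e, dinc e y & dlab e = Wall i (gap (dlab y)).
  by apply: cell_in_closure => //; rewrite (faceE fy) sy /= !eqxx.
have [d [y' [ed Ed ey' Ey']]] := wall_faces Ee.
have yy : y' = y by apply: (disk_immersed HD ey' ey); rewrite Ey' (faceE fy) sy.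
have dy : across d y.
  by exists i, (gap (dlab y)); rewrite Ed (faceE fy) sy; split=> //; exists e.
have cd : dinc c d by apply: (across_vert dy Ec).
have c'd : dinc c' d by apply: (across_vert dy Ec').
have [fd sd] : is_face (dlab d) /\ slab (dlab d) = i by rewrite Ed.
apply: (@connect_trans _ _ d); first exact: (left_vconn Ec).
exact: (left_vconn Ec').
Qed.

(** The shared strand starts at a vertex whose star has two faces on the right, and an admissible
    star of this kind also has a face on the left. *)
Lemma vadj_touch y y' i : vadj y y' -> y != y' -> slab (dlab y) = i.+1 ->
  exists x, touch x y /\ touch x y'.
Proof.
move=> yy' nyy sy; have [fy fy' sy' [h [e Ee [ey ey']] _]] := vadj_face yy'.
rewrite sy in Ee sy'.
have /and4P[_ _ _] := cell_okP e; rewrite Ee /= => vv.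
have [c ce Ec] : exists2 c, dinc c e & dlab c = Vert i (left_end W i h).
  apply: cell_in_closure => //; rewrite Ee /= !eqxx.
  by have := cell_valid e; rewrite Ee /= => /andP[->].
have vc : is_vert (dlab c) by rewrite Ec.
have cy := disk_trans HD ce ey; have cy' := disk_trans HD ce ey'.
have [s sin ss] := star_allowed vc.
have := vertexP vc; rewrite Ec in sin *; case/and3P=> /allP/(_ _ sin)/and3P[_ sok _] _ _.
have lx : [seq gap f | f <- s & slab f == i] != [::].
  apply: (implyP sok); move: (starP cy fy) (starP cy' fy'); rewrite !ss => y1 y2.
  have : dlab y \in [seq f <- s | slab f == i.+1] by rewrite mem_filter sy eqxx.
  have : dlab y' \in [seq f <- s | slab f == i.+1] by rewrite mem_filter -sy' eqxx.
  case: [seq f <- s | slab f == i.+1] => [//|f1 [|//]]; rewrite !inE => /eqP E1 /eqP E2.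
  by case/eqP: nyy; apply: (disk_immersed HD cy cy'); rewrite E1.
case El: [seq f <- s | slab f == i] lx => [//|f l] _.
have : f \in [seq f <- s | slab f == i] by rewrite El inE eqxx.
rewrite mem_filter -ss => /andP[/eqP sf /mem_starP[x cx [Ex fx]]].
rewrite -Ex in sf fx.
by exists x; split; exists i, (left_end W i h), c.
Qed.

Lemma touch_conn y y' x x' : connect vadj y y' -> touch x y -> touch x' y' ->
  connect vadj x x'.
Proof.
case/connectP=> p pp ->; elim: p y x pp => [|z p IHp] y x /=; first by move=> _; apply: touch_vconn.
case/andP=> yz zp xy x'z; have [E|nyz] := eqVneq y z.
  by apply: (IHp z) => //; rewrite -E.
have sy : slab (dlab y) = (slab (dlab x)).+1 by case: xy => i [v [c [_ [_ _ -> ->]]]].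
have [t [ty tz]] := vadj_touch yz nyz sy.
exact: connect_trans (touch_vconn xy ty) (IHp z t zp tz x'z).
Qed.

Lemma star_uniq c : uniq (star c).
Proof.
rewrite map_inj_in_uniq => [|x y]; first by apply: filter_uniq; apply: enum_uniq.
rewrite !mem_filter => /andP[/andP[cx _] _] /andP[/andP[cy _] _].
exact: (disk_immersed HD cx cy).
Qed.

Lemma star_corner c s q : at_crossing W (dlab c) -> star c =i s -> uniq s ->
  s = quadrant_faces (dlab c) q -> corner W q c.
Proof.
by move=> atc ss us E; rewrite /corner atc -E uniq_perm ?star_uniq.
Qed.

Lemma across_wall x f : is_face (dlab x) -> valid_cell W (Wall (slab (dlab x)) f) ->
  left_gap W (slab (dlab x)) f = gap (dlab x) ->
  exists2 y, across x y & dlab y = Face (slab (dlab x)).+1 f.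
Proof.
move=> fx vw lg.
have [e ex Ee] : exists2 e, dinc e x & dlab e = Wall (slab (dlab x)) f.
  by apply: cell_in_closure => //; rewrite [X in incident _ _ X](faceE fx) /= lg !eqxx orbT.
have [x' [y [ex' Ex' ey Ey]]] := wall_faces Ee.
by exists y => //; exists (slab (dlab x)), f; split=> //; exists e.
Qed.

Lemma across_or_closes d : is_face (dlab d) -> slab (dlab d) < size W ->
  let k := (gap (dlab d)).-1 in
  [/\ gap (dlab d) = k.+1, at_crossing W (Vert (slab (dlab d)) k) &
      valid_cell W (Vert (slab (dlab d)) k)] \/
  exists f y, [/\ left_gap W (slab (dlab d)) f = gap (dlab d), across d y &
    dlab y = Face (slab (dlab d)).+1 f].
Proof.
move=> fd lt; have [_ bd] := disk_valid HD d.
have := cell_okP d; case/and4P=> _ _ + _; rewrite (faceE fd) /face_ok -(faceE fd) bd lt !implyTb.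
case/andP=> _ /orP[/andP[/andP[g0 atc] vv]|]; first by left; rewrite prednK.
case/hasP=> f _ /andP[vw /eqP lg]; right.
by have [y dy Ey] := across_wall fd vw lg; exists f, y.
Qed.

(** A face that does not continue lies in the left quadrant of a crossing. If that quadrant is not
    the whole star, the star has another face in the same vertical component, and this one
    continues, since only one gap closes on a wall. *)
Lemma rightwards d : is_face (dlab d) -> slab (dlab d) < size W ->
  (exists2 c, corner W QLeft c & dinc c d /\ exists v, dlab c = Vert (slab (dlab d)) v) \/
  (exists x y, connect vadj d x /\ across x y).
Proof.
move=> fd lt; have [|[f [y [_ dy _]]]] := across_or_closes fd lt; last by right; exists d, y.
set k := (gap (dlab d)).-1 => -[gk atc vv].
have Ek : k = spot (ev W (slab (dlab d))) by case/and3P: atc => _ _ /eqP.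
have cr : is_cross (ev W (slab (dlab d))) by case/and3P: atc.
have [c cd Ec] : exists2 c, dinc c d & dlab c = Vert (slab (dlab d)) k.
  apply: cell_in_closure => //; rewrite [X in incident _ _ X](faceE fd) /= gk eqxx /=.
  move: cr; rewrite /right_end lt Ek; case: (ev W _) => //= k' _.
  by rewrite (ltn_eqF (ltnSn k')) eqxx !orbT.
have vc : is_vert (dlab c) by rewrite Ec.
have [s sin ss] := star_allowed vc.
have := vertexP vc; rewrite Ec in sin *; case/and3P=> /allP/(_ _ sin)/and3P[_ _ sok] _ _.
have din : k.+1 \in [seq gap f | f <- s & slab f == slab (dlab d)].
  by rewrite -gk; apply: map_f; rewrite mem_filter eqxx -ss starP.
move: sok; rewrite atc din => /orP[/eqP Es|/hasP[g + gn]].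
  left; exists c; last by split=> //; exists k.
  by apply: (star_corner _ ss); rewrite ?Ec // Es.
case/mapP=> f; rewrite mem_filter -ss => /andP[/eqP sf /mem_starP[x cx [Ex fx]]] gf.
rewrite -Ex in sf fx gf; right; exists x.
have dx : connect vadj d x by apply: (left_vconn Ec).
have lx : slab (dlab x) < size W by rewrite sf.
have [[gx /and3P[_ _ /eqP ex] _]|[f' [y [_ xy _]]]] := across_or_closes fx lx; last by exists y.
by move: gn; rewrite /= gf gx ex sf -Ek eqxx.
Qed.

Lemma positive_dpos c : corner W QLeft c \/ corner W QRight c -> c = dpos D.
Proof. by move=> cc; apply/eqP; rewrite -(disk_positive HD); apply/orP. Qed.

Lemma left_right_corner c : corner W QLeft c -> corner W QRight c -> False.
Proof.
case/andP=> _ pl /andP[atc pr]; case: (dlab c) atc pl pr => //= j k _ pl pr.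
have := perm_mem pl (Face j k.+1); rewrite (perm_mem pr) !inE eqxx.
by move/eqP => [/eqP]; rewrite (ltn_eqF (ltnSn j)).
Qed.

Lemma across_inj x d d' : across x d -> across x d' -> dlab d = dlab d' -> d = d'.
Proof.
case=> i [f [Ed _ _ [e [Ee ex ed]]]] [i' [f' [Ed' _ _ [e' [Ee' ex' ed']]]]] dd.
have ee : e = e' by apply: (cell_closure_inj ex ex'); rewrite Ee Ee'; move: dd; rewrite Ed Ed' => -[-> ->].
by rewrite -ee in ed'; apply: (disk_immersed HD ed ed').
Qed.

(* The tail of a resolution: from wall n on, the strands 2m and 2m + 1 cross
   once, on wall n + m, before being joined. *)
Variable n : nat.
Hypothesis tail_cross : forall i, n <= i < size W -> ev W i = Cross (i - n).*2.
Hypothesis tail_width : width W (size W) = (size W - n).*2.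

(** In the tail a gap keeps its number across each wall, and only odd gaps close at a crossing or
    survive to the last slab. *)
Lemma tail_odd d : is_face (dlab d) -> n <= slab (dlab d) -> odd (gap (dlab d)).
Proof.
move: {2}(_ - _) (erefl (size W - slab (dlab d))) => r.
elim: r d => [|r IHr] d sr fd nd; have [_ _ le o] := face_bounded fd.
  by case: o => //; rewrite ltnNge -subn_eq0 sr.
have lt : slab (dlab d) < size W by rewrite -subn_gt0 sr.
have Ew := tail_cross (introT andP (conj nd lt)).
have [[gk /and3P[_ _ /eqP sp] _]|[f [y [lg _ Ey]]]] := across_or_closes fd lt.
  by rewrite gk sp Ew /= odd_double.
move: lg; rewrite /left_gap Ew => <-.
have := IHr y; rewrite Ey /=; apply=> //; first by rewrite subnS sr.
exact: leqW.
Qed.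

(** The gap 2m + 1 is traced to the left until the wall n + m, where it opens. The star at that
    crossing must be the right quadrant: any other star either contains an even gap, excluded in the
    tail, or is the left quadrant, which misses [d]. *)
Lemma tail_back d i m : dlab d = Face i.+1 m.*2.+1 -> n + m <= i ->
  (i = n + m /\ exists c, [/\ corner W QRight c, dlab c = Vert i m.*2 & dinc c d]) \/
  (n + m < i /\ exists2 x, across x d & dlab x = Face i m.*2.+1).
Proof.
move=> Ed le; have fd : is_face (dlab d) by rewrite Ed.
have [g0 gw lei _] := face_bounded fd; rewrite Ed /= in g0 gw lei.
have ni : n <= i by apply: leq_trans le; apply: leq_addr.
have Ew := tail_cross (introT andP (conj ni lei)).
have := cell_okP d; case/and4P=> _ _ + _.
have [_ bd] := disk_valid HD d; rewrite Ed in bd.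
rewrite Ed /face_ok bd Ew => /andP[/andP[_ /orP[/eqP mE|vw]] _]; last first.
  have [e ed Ee] : exists2 e, dinc e d & dlab e = Wall i m.*2.+1.
    by apply: cell_in_closure => //; rewrite Ed /= !eqxx.
  have [x [y [ex Ex _ _]]] := wall_faces Ee; rewrite /left_gap Ew in Ex.
  right; split; last first.
    by exists x => //; exists i, m.*2.+1; rewrite Ed Ex; split=> //; exists e.
  move: le; rewrite leq_eqVlt => /orP[/eqP ni'|//]; move: vw.
  by rewrite /= Ew /= -ni' addKn eqxx !andbF.
have {mE} mi : m = i - n by move: mE => /= [] /double_inj.
left; split; first by rewrite mi subnKC.
have atc : at_crossing W (Vert i m.*2) by rewrite /= lei Ew -mi eqxx.
have [c cd Ec] : exists2 c, dinc c d & dlab c = Vert i m.*2.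
  apply: cell_in_closure; rewrite ?Ed /= lei ?(ltnW gw) ?Ew /left_end ?Ew /= -?mi ?eqxx //=.
    by rewrite (ltn_eqF (ltnSn _)).
  by rewrite (ltn_eqF (ltnSn _)) eqxx.
exists c; split=> //.
have vc : is_vert (dlab c) by rewrite Ec.
have oddstar f : f \in star c -> odd (gap f).
  case/mem_starP=> x cx [Ex fx]; rewrite -Ex in fx *; apply: tail_odd => //.
  have := disk_incident HD cx; rewrite Ec (faceE fx) /= => /orP[/and3P[/eqP-> _ _]|/andP[/eqP-> _]] //.
  exact: leqW.
have inR : Face i.+1 m.*2.+1 \in star c by rewrite -Ed starP.
have [full|[s sin /perm_mem ps]|[[] cq]] := disk_vert HD vc => //.
- have /oddstar : Face i.+1 m.*2.+2 \in star c; last by rewrite /= !negbK odd_double.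
  apply: full; rewrite ?Ec //= ?lei //.
  by rewrite eqxx /left_end Ew /= -mi eqxx /= eqxx.
- have ev k : k \in s -> odd (gap k) by rewrite -ps; apply: oddstar.
  move: sin; rewrite Ec /sides atc !inE => /or4P[]/eqP sE; move: ev; rewrite sE.
  + by move/(_ (Face i m.*2.+2)); rewrite !inE eqxx /= negbK odd_double => /(_ isT).
  + by move/(_ (Face i m.*2)); rewrite !inE eqxx ?orbT /= odd_double => /(_ isT).
  + by move/(_ (Face i m.*2.+2)); rewrite !inE eqxx /= negbK odd_double => /(_ isT).
  + by move/(_ (Face i m.*2)); rewrite !inE eqxx ?orbT /= odd_double => /(_ isT).
- case/andP: cq => _ /perm_mem/(_ (Face i.+1 m.*2.+1)); rewrite inR Ec /= inE => /esym/eqP[/eqP].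
  by rewrite (gtn_eqF (ltnSn i)).
- case/andP: cq => _ /perm_mem/(_ (Face i m.*2.+2)); rewrite Ec /= !inE eqxx => /oddstar.
  by rewrite /= negbK odd_double.
- case/andP: cq => _ /perm_mem/(_ (Face i m.*2)); rewrite Ec /= !inE eqxx => /oddstar.
  by rewrite /= odd_double.
Qed.

Lemma tail_right_corner d i m : dlab d = Face i.+1 m.*2.+1 -> n + m <= i ->
  corner W QRight (dpos D) /\ dlab (dpos D) = Vert (n + m) m.*2.
Proof.
elim: i d => [|i IHi] d Ed le; have [[Ei [c [cr Ec cd]]]|[lt [x _ Ex]]] := tail_back Ed le => //.
- by rewrite -Ei -(positive_dpos (or_intror cr)).
- by rewrite -Ei -(positive_dpos (or_intror cr)).
exact: (IHi x).
Qed.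

(** Both faces are traced back to the positive corner, where the disk is immersed; equality then
    propagates to the right across the walls. *)
Lemma tail_inj d d' i m : dlab d = Face i.+1 m.*2.+1 -> dlab d' = dlab d -> n + m <= i -> d = d'.
Proof.
elim: i d d' => [|i IHi] d d' Ed Ed' le; have := Ed'; rewrite Ed => /tail_back/(_ le);
  have [[Ei [c [cr Ec cd]]]|[lt [x xd Ex]]] := tail_back Ed le => //;
  case=> [[Ei' [c' [cr' Ec' cd']]]|[lt' [x' xd' Ex']]] //.
- apply: (disk_immersed HD (c := dpos D)) => //.
    by rewrite -(positive_dpos (or_intror cr)).
  by rewrite -(positive_dpos (or_intror cr')).
- apply: (disk_immersed HD (c := dpos D)) => //.
    by rewrite -(positive_dpos (or_intror cr)).
  by rewrite -(positive_dpos (or_intror cr')).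
- by rewrite Ei ltnn in lt'.
- by rewrite Ei' ltnn in lt.
have xx : x = x' by apply: IHi => //; rewrite Ex.
by rewrite -xx in xd'; apply: (across_inj xd xd').
Qed.

Lemma last_face d : is_face (dlab d) -> slab (dlab d) = size W -> exists i m,
  [/\ dlab d = Face i.+1 m.*2.+1, size W = i.+1 & n + m <= i].
Proof.
move=> fd sd; have [g0 gw _ o] := face_bounded fd.
have {o} o : odd (gap (dlab d)) by case: o => //; rewrite sd ltnn.
rewrite sd tail_width in gw.
have gE : gap (dlab d) = (gap (dlab d))./2.*2.+1 by rewrite -[LHS]odd_double_half o.
have lt : (gap (dlab d))./2 < size W - n by rewrite -ltn_double; apply: leq_ltn_trans gw; rewrite {2}gE.
exists (size W).-1, (gap (dlab d))./2.
have sz : size W = (size W).-1.+1 by rewrite prednK //; apply: leq_ltn_trans (leq0n _) (leq_trans lt (leq_subr _ _)).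
split=> //; first by rewrite -sz -gE -sd -faceE.
by rewrite -ltnS -sz -ltn_subRL.
Qed.

(** Following a face to the right ends either in the last slab, and then in a loop with its right
    corner in the tail, or at a left corner, which therefore lies to the right of the face. *)
Lemma terminal d : is_face (dlab d) -> corner W QRight (dpos D) \/
  corner W QLeft (dpos D) /\ exists i v, dlab (dpos D) = Vert i v /\ slab (dlab d) <= i.
Proof.
move: {2}(_ - _) (erefl (size W - slab (dlab d))) => r.
elim: r d => [|r IHr] d sr fd; have [_ _ le _] := face_bounded fd.
  have sd : slab (dlab d) = size W by apply/eqP; rewrite eqn_leq le -subn_eq0 sr.
  have [i [m [Ed _ le']]] := last_face fd sd.
  by left; have [] := tail_right_corner Ed le'.
have lt : slab (dlab d) < size W by rewrite -subn_gt0 sr.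
have [[c cl [cd [v Ec]]]|[x [y [dx xy]]]] := rightwards fd lt.
  right; rewrite -(positive_dpos (or_introl cl)); split=> //.
  by exists (slab (dlab d)), v.
have [fx sx] := vconn_face dx fd; have [i [f [Ey sx' _ _]]] := xy.
have {}Ey : dlab y = Face (slab (dlab d)).+1 f by rewrite -sx sx' Ey.
have := IHr y; rewrite Ey /= => /(_ _ isT) [|//|[cl [i' [v [Ec lt']]]]].
- by rewrite subnS sr.
- by left.
by right; split=> //; exists i', v; split=> //; apply: ltnW.
Qed.

(* A face continues to the right except at the positive corner and on the last
   wall.  Two faces of a slab thus lead to faces of the next slab, which are
   connected by induction, and connectedness is carried back across the wall. *)
Lemma slab_vconn d d' : is_face (dlab d) -> is_face (dlab d') ->
  slab (dlab d) = slab (dlab d') -> connect vadj d d'.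
Proof.
move: {2}(_ - _) (erefl (size W - slab (dlab d))) => r.
elim: r d d' => [|r IHr] d d' sr fd fd' sd; have [_ _ le _] := face_bounded fd.
  have sz : slab (dlab d) = size W by apply/eqP; rewrite eqn_leq le -subn_eq0 sr.
  have [i [m [Ed Ei le']]] := last_face fd sz; rewrite sd in sz.
  have [i' [m' [Ed' Ei' le'']]] := last_face fd' sz.
  have [_ Ec] := tail_right_corner Ed le'; have [_] := tail_right_corner Ed' le''.
  rewrite Ec => -[/addnI mm _].
  have ii : i = i' by apply: succn_inj; rewrite -Ei.
  by rewrite (@tail_inj d d' i m) ?connect0 // Ed' Ed ii mm.
have lt : slab (dlab d) < size W by rewrite -subn_gt0 sr.
have lt' : slab (dlab d') < size W by rewrite -sd.
(* If one face stopped at a left corner while the other continued, [terminal] applied further right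
   would put the positive corner beyond that wall or make it a right quadrant. *)
have no_split e x y c : is_face (dlab e) -> corner W QLeft c ->
    (exists v, dlab c = Vert (slab (dlab e)) v) -> slab (dlab x) = slab (dlab e) ->
    across x y -> False.
  move=> fe cl [v Ec] sx [i [f [Ey sx' _ _]]]; have Ecp := positive_dpos (or_introl cl).
  have fy : is_face (dlab y) by rewrite Ey.
  have [cr|[_ [i' [v' [Ec' lei]]]]] := terminal fy.
    by apply: (@left_right_corner c) => //; rewrite Ecp.
  move: Ec' lei; rewrite -Ecp Ec Ey /= => -[<- _].
  by rewrite -sx sx' ltnn.
have [[c cl [cd Ec]]|[x [y [dx xy]]]] := rightwards fd lt;
have [[c' cl' [cd' Ec']]|[x' [y' [dx' xy']]]] := rightwards fd' lt'.
- have [v Ev] := Ec; apply: (left_vconn Ev cd _ fd fd') => //.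
  by rewrite (positive_dpos (or_introl cl)) -(positive_dpos (or_introl cl')).
- have [_ sx'] := vconn_face dx' fd'.
  by case: (no_split d x' y' c fd cl Ec) => //; rewrite sx'.
- have [_ sx] := vconn_face dx fd.
  by case: (no_split d' x y c' fd' cl' Ec') => //; rewrite sx.
have [_ sx] := vconn_face dx fd; have [_ sx'] := vconn_face dx' fd'.
have [i [f [Ey si _ _]]] := xy; have [i' [f' [Ey' si' _ _]]] := xy'.
have ii : i' = i by rewrite -si -si' sx sx'.
have yy : connect vadj y y'.
  by apply: IHr; rewrite ?Ey ?Ey' //= ?ii // -si sx subnS sr.
apply: (connect_trans dx); apply: connect_trans (touch_conn yy (across_touch xy) (across_touch xy')) _.
by rewrite vconn_sym.
Qed.

(** * Injectivity of the labels *)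

Lemma face_label_inj d d' : is_face (dlab d) -> dlab d = dlab d' -> d = d'.
Proof.
by move=> fd dd; apply: vconn_inj => //; apply: slab_vconn; rewrite -?dd.
Qed.

Lemma wall_label_inj c c' : is_wall (dlab c) -> dlab c = dlab c' -> c = c'.
Proof.
case Ec: (dlab c) => [|?|i f|] // _ Ec'.
have [_ [y [_ _ cy Ey]]] := wall_faces Ec.
have [_ [y' [_ _ c'y Ey']]] := wall_faces (esym Ec').
have yy : y = y' by apply: face_label_inj; rewrite Ey ?Ey'.
by rewrite -yy in c'y; apply: (cell_closure_inj cy c'y); rewrite Ec.
Qed.

(** Two copies of a strand could a priori see the disk on opposite sides. The two faces are then
    neighbours in one vertical component, and the strand that they share is both copies. *)
Lemma strand_label_inj c c' : is_strand (dlab c) -> dlab c = dlab c' -> c = c'.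
Proof.
move=> sc cc; have nf x : dlab x = dlab c -> ~~ is_face (dlab x) by move->; case: (dlab c) sc.
have [d cd fd] := disk_pure HD (nf _ erefl).
have [d' cd' fd'] := disk_pure HD (nf _ (esym cc)).
case Ec: (dlab c) sc => [|j h||] // _.
have := disk_incident HD cd; have := disk_incident HD cd'; rewrite -cc Ec.
rewrite (faceE fd) (faceE fd') /= => /andP[/eqP sd' gd'] /andP[/eqP sd gd].
have dd := slab_vconn fd fd' (etrans sd (esym sd')).
have glue x y z z' : dlab z = dlab c -> dlab z' = dlab c -> dinc z x -> dinc z' y ->
    is_face (dlab x) -> slab (dlab x) = j -> connect vadj x y ->
    gap (dlab x) = h -> gap (dlab y) = h.+1 -> z = z'.
  move=> Ez Ez' zx z'y fx sx xy gx gy.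
  have [t [xt gt ty]] : exists t, [/\ vadj x t, gap (dlab t) = (gap (dlab x)).+1 & connect vadj t y].
    by apply: vconn_step; rewrite ?gx ?gy.
  have [_ ft st [h' [e Ee [ex et]] hh]] := vadj_face xt.
  have [fy sy] := vconn_face ty ft.
  have ty' : t = y by apply: vconn_inj => //; rewrite (faceE fy) (faceE ft) sy gt gx gy.
  have Eh : h' = h by rewrite (common_edge (or_introl gt) hh) gt gx (minn_idPl (leqnSn _)).
  have Ee' : dlab e = dlab c by rewrite Ee sx Eh Ec.
  rewrite (cell_closure_inj zx ex) ?Ez ?Ee' //.
  by rewrite ty' in et; apply: (cell_closure_inj et z'y); rewrite Ez'.
case/orP: gd => /eqP gd; case/orP: gd' => /eqP gd'.
- have E : d = d' by apply: vconn_inj => //; rewrite (faceE fd) (faceE fd') sd sd' gd gd'.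
  by rewrite -E in cd'; apply: (cell_closure_inj cd cd').
- by apply: (glue d d').
- by symmetry; apply: (glue d' d); rewrite // vconn_sym.
- have E : d = d' by apply: vconn_inj => //; rewrite (faceE fd) (faceE fd') sd sd' gd gd'.
  by rewrite -E in cd'; apply: (cell_closure_inj cd cd').
Qed.

(** Copies of a vertex that see a common slab agree by [vconn_vertex]. Otherwise one sees only the
    left slab and the other only the right one; their stars are then the two positive quadrants of a
    crossing, so both copies are the positive corner. *)
Lemma vert_label_inj c c' : is_vert (dlab c) -> dlab c = dlab c' -> c = c'.
Proof.
move=> vc cc; have vc' : is_vert (dlab c') by rewrite -cc.
have nf x : dlab x = dlab c -> ~~ is_face (dlab x) by move->; case: (dlab c) vc.
have [d cd fd] := disk_pure HD (nf _ erefl).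
have [d' cd' fd'] := disk_pure HD (nf _ (esym cc)).
case Ec: (dlab c) (vc) => [i v|||] // _.
have sl e x : dlab e = dlab c -> dinc e x -> is_face (dlab x) ->
    slab (dlab x) = i \/ slab (dlab x) = i.+1.
  move=> Ee ex fx; have := disk_incident HD ex; rewrite Ee Ec (faceE fx) /=.
  by case/orP=> [/andP[/eqP-> _]|/andP[/eqP-> _]]; [right|left].
have same x y : dinc c x -> dinc c' y -> is_face (dlab x) -> is_face (dlab y) ->
    slab (dlab x) = slab (dlab y) -> c = c'.
  by move=> cx cy fx fy ss; apply: (@vconn_vertex c c' x y) => //; apply: slab_vconn.
have all_slab e j : dlab e = dlab c -> (exists2 x, dinc e x & is_face (dlab x) /\ slab (dlab x) = j) \/
    all (fun f => slab f != j) (star e).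
  move=> Ee; case: (boolP (all _ _)) => [|/allPn[f /mem_starP[x ex [<- fx]]]]; first by right.
  by rewrite negbK => /eqP sx; left; exists x.
have opposite e e' : dlab e = dlab c -> dlab e' = dlab c ->
    all (fun f => slab f != i.+1) (star e) -> all (fun f => slab f != i) (star e') -> e = e'.
  move=> Ee Ee' /allP al /allP al'.
  have [s sin ss] : exists2 s, s \in stars (dlab e) & star e =i s.
    by apply: star_allowed; rewrite Ee.
  have [s' sin' ss'] : exists2 s, s \in stars (dlab e') & star e' =i s.
    by apply: star_allowed; rewrite Ee'.
  have := vertexP vc; rewrite Ee in sin; rewrite Ee' in sin'.
  rewrite Ec in sin sin' *; case/and3P=> _ _ /allP/(_ _ sin)/allP/(_ _ sin').
  have -> : all (fun f => slab f == i) s.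
    apply/allP=> f; rewrite -ss => fs; have := al _ fs; case/mem_starP: fs => x ex [<- fx].
    by case: (sl e x Ee ex fx) => -> //; rewrite eqxx.
  have -> : all (fun f => slab f == i.+1) s'.
    apply/allP=> f; rewrite -ss' => fs; have := al' _ fs; case/mem_starP: fs => x ex [<- fx].
    by case: (sl e' x Ee' ex fx) => -> //; rewrite eqxx.
  case/and3P=> atc /eqP E /eqP E'.
  have cl : corner W QLeft e by apply: (star_corner _ ss); rewrite ?Ee ?Ec // E.
  have cr : corner W QRight e' by apply: (star_corner _ ss'); rewrite ?Ee' ?Ec // E'.
  by rewrite (positive_dpos (or_introl cl)) (positive_dpos (or_intror cr)).
have ec' : dlab c' = dlab c by [].
have [[x cx [fx sx]]|nx] := all_slab c i.+1 erefl; last first.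
  have [[y cy [fy sy]]|ny] := all_slab c' i ec'; last exact: opposite.
  have [[x cx [fx sx]]|/allP nx'] := all_slab c i erefl; first by apply: (same x y); rewrite ?sx ?sy.
  have := starP cd fd; case: (sl c d erefl cd fd) => sd din.
    by have := nx' _ din; rewrite sd eqxx.
  by move/allP/(_ _ din): nx; rewrite sd eqxx.
have [[y cy [fy sy]]|ny] := all_slab c' i.+1 ec'; first by apply: (same x y); rewrite ?sx ?sy.
have [[z cz [fz sz]]|nz] := all_slab c i erefl; last by symmetry; apply: opposite.
case: (sl c' d' ec' cd' fd') => sd'; first by apply: (same z d'); rewrite ?sz ?sd'.
by move/allP/(_ _ (starP cd' fd')): ny; rewrite sd' eqxx.
Qed.

Theorem dlab_inj : injective (@dlab D).
Proof.
move=> c c' cc; case Ec: (dlab c) => [i v|j h|i f|j g].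
- by apply: vert_label_inj; rewrite // Ec.
- by apply: strand_label_inj; rewrite // Ec.
- by apply: wall_label_inj; rewrite // Ec.
- by apply: face_label_inj; rewrite // Ec.
Qed.

End Disk.
End Cells.

(** * Enumeration of the disks *)

Section Model.

Variable W : seq event.

Definition model (p : cell) (s bnd : seq cell) : disk_data :=
  @DiskData (size s).+1
    (fun i j => incident W (nth p (p :: s) i) (nth p (p :: s) j))
    (fun i => nth p (p :: s) i)
    [seq inord (index x (p :: s)) | x <- bnd] ord0.

Definition trans_ok : bool :=
  all (fun y => all (fun x => all (incident W x) [seq z <- cells W | incident W y z])
                    [seq x <- cells W | incident W x y]) (cells W).

Section LabelLevel.

Variables (p : cell) (s : seq cell).
Let S := p :: s.

(* The prefix l marks a notion of disks computed from the labels of the cells,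
   here the list p :: s. *)
Definition lstar (x : cell) : seq cell := [seq f <- S | incident W x f && is_face f].
Definition lcorner (q : quadrant) (x : cell) : bool :=
  at_crossing W x && perm_eq (lstar x) (quadrant_faces x q).
Definition lboundary (x : cell) : bool := is_strand x && (size (lstar x) == 1).
Definition lrightward (x : cell) : bool :=
  if x is Strand j h then Face j h.+1 \in lstar x else false.
Definition lend (side : bool) (e c : cell) : bool :=
  if incident W c e then
    match e, c with
    | Strand j _, Vert i _ => if side (+) lrightward e then i.+1 == j else i == j
    | _, _ => false
    end
  else false.
Definition lsource := lend false.
Definition ltarget := lend true.
Definition lconsec (e e' : cell) : bool := has (lsource e') [seq c <- S | ltarget e c].

(* The faces are visited from right to left and back, each followed by its
   boundary, so that one pass reaches every cell of a disk. *)
Definition grow (r : seq cell) : seq cell :=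
  foldl (fun r x => if (x \notin r) && has (fun y => incident W x y || incident W y x) r
                    then x :: r else r) r
    (flatten [seq f :: [seq x <- S | incident W x f] | f <- rev S ++ S & is_face f]).

Definition model_ok (bnd : seq cell) : bool :=
  [&& [&& uniq S, all (fun x => valid_cell W x && bounded_face W x) S,
          all (fun d => all (mem S) [seq x <- cells W | incident W x d]) S,
          all (fun c => is_face c || (lstar c != [::])) S &
          all (fun c => all (mem (lstar c)) (faces_at W c)) [seq c <- S | is_wall c]],
      all (fun c =>
        [|| all (mem (lstar c)) (faces_at W c), has (perm_eq (lstar c)) (sides W c) |
            [|| lcorner QLeft c, lcorner QRight c, lcorner QTop c | lcorner QBottom c]])
        [seq c <- S | is_vert c],
      all (mem (grow [:: p])) S,
      count is_vert S + count is_face S == count is_edge S + 1,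
      all (fun x => (lcorner QLeft x || lcorner QRight x) == (x == p)) S &
      perm_eq bnd [seq e <- S | lboundary e] &&
      if bnd is e :: l then
        [&& lsource e p, path lconsec e l & ltarget (last e l) p]
      else false].

Lemma map_model (T : Type) (f : cell -> T) bnd :
  [seq f (dlab i) | i <- enum (dcell (model p s bnd))] = map f S.
Proof.
rewrite -[in RHS](mkseq_nth p S) /mkseq -val_enum_ord -!map_comp.
exact: eq_map.
Qed.

Lemma count_model (a : pred cell) bnd :
  #|[pred c : dcell (model p s bnd) | a (dlab c)]| = count a S.
Proof.
rewrite -[in RHS](map_id S) -(map_model id bnd) count_map cardE size_filter -enumT.
exact: eq_count.
Qed.

Lemma mem_model x bnd : x \in S -> exists i : dcell (model p s bnd), dlab i = x.
Proof.
move=> xS; have lt : index x S < (size s).+1 by rewrite [X in _ < X](_ : _ = size S) // index_mem.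
by exists (Ordinal lt) => /=; apply: nth_index.
Qed.

Lemma has_model (a : pred cell) bnd :
  [exists c : dcell (model p s bnd), a (dlab c)] = has a S.
Proof.
apply/existsP/hasP => [[c ac]|[x xS ax]]; first by exists (dlab c) => //; apply: mem_nth.
by have [i Ei] := mem_model bnd xS; exists i; rewrite Ei.
Qed.

Variable bnd : seq cell.
Let M := model p s bnd.

Lemma dinc_model (c d : dcell M) : dinc c d = incident W (dlab c) (dlab d).
Proof. by []. Qed.

Lemma star_model (c : dcell M) : star c = lstar (dlab c).
Proof.
by rewrite /star /lstar -[in RHS](map_id S) -(map_model id bnd) filter_map.
Qed.

Lemma corner_model q (c : dcell M) : corner W q c = lcorner q (dlab c).
Proof. by rewrite /corner star_model. Qed.

Lemma rightward_model (e : dcell M) : rightward e = lrightward (dlab e).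
Proof. by rewrite /rightward star_model. Qed.

Lemma source_model (e c : dcell M) : source e c = lsource (dlab e) (dlab c).
Proof.
rewrite /source /end_point /lsource /lend rightward_model /=.
by case: (lrightward _); case: (incident _ _ _).
Qed.

Lemma target_model (e c : dcell M) : target e c = ltarget (dlab e) (dlab c).
Proof.
rewrite /target /end_point /ltarget /lend rightward_model /=.
by case: (lrightward _); case: (incident _ _ _).
Qed.

Lemma consec_model (e e' : dcell M) : consecutive e e' = lconsec (dlab e) (dlab e').
Proof.
rewrite /consecutive /= /lconsec has_filter -filter_predI -has_filter -(has_model _ bnd).
apply: eq_existsb => c; rewrite [RHS]andbC.
by rewrite source_model target_model.
Qed.

Hypothesis ok : model_ok bnd.

Lemma model_uniq : uniq S.
Proof. by case/and5P: ok => /and5P[]. Qed.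

Lemma model_inj : injective (@dlab M).
Proof.
move=> i j /= ij; apply/val_inj/eqP.
by rewrite -(nth_uniq p _ _ model_uniq) ?ij //; apply: ltn_ord.
Qed.

Lemma map_dbound : map (@dlab M) (dbound M) = bnd.
Proof.
case/and5P: ok => _ _ _ _ /andP[_ /andP[/perm_mem pb _]].
rewrite -map_comp -[RHS]map_id; apply/eq_in_map => x; rewrite pb mem_filter => /andP[_ xS].
have lt : index x S < (size s).+1 by rewrite -[(size s).+1]/(size S) index_mem.
change (nth p S (inord (index x S) : 'I_(size s).+1) = x).
by rewrite inordK // nth_index.
Qed.

Hypothesis tok : trans_ok.

Lemma model_disk : immersed_disk W M.
Proof.
have us := model_uniq; have inS (c : dcell M) : dlab c \in S by apply: mem_nth.
case/and5P: ok => /and5P[_ /allP valS /allP closS /allP pureS /allP wallS].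
move=> /allP vertS /allP growS /eqP eulS /andP[/allP posS /andP[pb cyc]].
have vS (c : dcell M) : valid_cell W (dlab c) by case/andP: (valS _ (inS c)).
split.
- by move=> c; apply/andP/valS.
- by [].
- move=> y x z xy yz; have cellsS (c : dcell M) : dlab c \in cells W by rewrite mem_cells.
  have /allP/(_ (dlab x)) := allP tok _ (cellsS y).
  rewrite mem_filter -dinc_model xy cellsS => /(_ isT)/allP/(_ (dlab z)).
  by rewrite mem_filter -dinc_model yz cellsS; apply.
- move=> d x vx ix; have /allP/(_ x) := closS _ (inS d).
  rewrite mem_filter mem_cells ix vx => /(_ isT) /(mem_model bnd)[c Ec]; exists c.
  split=> [|c' [_ Ec']]; first by rewrite dinc_model Ec.
  by apply: model_inj; rewrite Ec Ec'.
- by move=> c d d' _ _ /model_inj.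
- move=> c nf; have := pureS _ (inS c); rewrite (negPf nf) /= -star_model.
  case E: (star c) => [//|x l] _; have : x \in star c by rewrite E inE eqxx.
  by case/mem_starP=> d cd [<- fd]; exists d.
- move=> c wc x vx fx ix; have /allP/(_ x) := wallS (dlab c) (etrans (mem_filter _ _ _) (introT andP (conj wc (inS c)))).
  by rewrite star_model; apply; rewrite mem_filter fx ix mem_cells.
- move=> c vc; have := vertS (dlab c) (etrans (mem_filter _ _ _) (introT andP (conj vc (inS c)))); case/or3P=> [/allP H|/hasP[l lin pl]|/or4P cq].
  + by constructor 1 => x vx fx ix; rewrite star_model; apply: H; rewrite mem_filter fx ix mem_cells.
  + by constructor 2; exists l; rewrite ?star_model.
  + by constructor 3; case: cq => cq; eexists; rewrite corner_model; exact: cq.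
- set R := [rel x y : dcell M | dinc x y || dinc y x].
  have Rsym : connect_sym R by apply: sym_connect_sym => x y; rewrite /R /= orbC.
  (* By symmetry it suffices to reach every cell from the positive corner, which is what [grow]
     certifies. *)
  suff from0 c : connect R (ord0 : dcell M) c.
    by move=> c d; apply: connect_trans (from0 d); rewrite Rsym.
  pose good (r : seq cell) := forall x, x \in r -> exists2 c : dcell M, dlab c = x & connect R (ord0 : dcell M) c.
  suff growP (r : seq cell) : good r -> good (grow r).
    suff [c' /model_inj -> //] : exists2 c', dlab c' = dlab c & connect R (ord0 : dcell M) c'.
    apply: (growP [:: p]); last exact: growS.
    by move=> x; rewrite inE => /eqP->; exists ord0; rewrite ?connect0.
  rewrite /grow; set l := flatten _; have : {subset l <= S}.
    move=> x /flatten_mapP[f]; rewrite mem_filter mem_cat mem_rev orbb => /andP[_ fS].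
    by rewrite in_cons => /orP[/eqP->//|]; rewrite mem_filter => /andP[].
  elim: l r => [|x l IHl] r sub gr //=; apply: IHl.
    by move=> y yl; apply: sub; rewrite inE yl orbT.
  case: ifP => // /andP[_ /hasP[y yr xy]] z; rewrite inE => /orP[/eqP->|]; last exact: gr.
  have [c' Ec' con] := gr _ yr; have [d Ed] := mem_model bnd (sub x (mem_head _ _)).
  exists d => //; apply: connect_trans con (connect1 _).
  change (incident W (dlab c') (dlab d) || incident W (dlab d) (dlab c')).
  by rewrite orbC Ec' Ed.
- by rewrite !count_model.
- move=> c; rewrite /positive_corner !corner_model (eqP (posS _ (inS c))).
  by apply/eqP/eqP=> [Ec|->//]; apply: model_inj.
- have bE e : (e \in dbound M) = lboundary (dlab e).
    by rewrite -(mem_map model_inj) map_dbound (perm_mem pb) mem_filter andb_idr.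
  have beE (e : dcell M) : boundary_edge e = lboundary (dlab e).
    by rewrite /boundary_edge star_model.
  split=> [e|]; first by rewrite bE -beE.
  rewrite -(map_inj_uniq model_inj) map_dbound (perm_uniq pb).
  exact: filter_uniq.
- have Eb := map_dbound; case: (dbound M) Eb => [|e l] Eb; first by rewrite -Eb in cyc.
  have /and3P[se pe te] : [&& lsource (dlab e) p, path lconsec (dlab e) (map (@dlab M) l)
      & ltarget (last (dlab e) (map (@dlab M) l)) p] by rewrite -Eb in cyc.
  exists e, l; split=> //.
  + by rewrite source_model.
  + rewrite path_map in pe; apply: sub_path pe => x y.
    by rewrite consec_model.
  + by rewrite target_model; rewrite last_map in te.
Qed.

End LabelLevel.

(** With injective labels the incidence of the disk is that of the plane: if [dlab c] lies in the
    closure of [dlab d], the cell over it in the closed cell of [d] is [c] itself. Since [disk_iso]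
    compares only cells and incidences, [bnd] is arbitrary. *)
Lemma model_iso D p s bnd : immersed_disk W D -> injective (@dlab D) -> uniq (p :: s) ->
  (forall x, reflect (exists c : dcell D, dlab c = x) (x \in p :: s)) ->
  disk_iso D (model p s bnd).
Proof.
move=> HD inj us img; have lt (c : dcell D) : index (dlab c) (p :: s) < (size s).+1.
  by rewrite -[(size s).+1]/(size (p :: s)) index_mem; apply/img; exists c.
pose f (c : dcell D) : dcell (model p s bnd) := Ordinal (lt c).
have fE c : dlab (f c) = dlab c.
  by apply: nth_index; apply/img; exists c.
exists f; split=> //.
- have ex (i : dcell (model p s bnd)) : exists c : dcell D, dlab c == dlab i.
    have /img[c Ec] : dlab i \in p :: s by apply: mem_nth.
    by exists c; rewrite Ec.
  exists (fun i => xchoose (ex i)) => [c|i].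
    by apply: inj; rewrite (eqP (xchooseP (ex (f c)))) fE.
  apply/val_inj/eqP; rewrite -(nth_uniq p _ _ us) //; try exact: ltn_ord.
  by rewrite -[nth p _ _]/(dlab (f _)) fE; apply: xchooseP (ex i).
- move=> c d; rewrite -[LHS]/(incident W (dlab (f c)) (dlab (f d))) !fE.
  apply/idP/idP => [icd|]; last exact: (disk_incident HD).
  have [c' c'd Ec'] := cell_in_closure HD (cell_valid HD c) icd.
  by rewrite -(inj c' c).
Qed.

Lemma iso_labels D D' : disk_iso D D' -> forall x,
  (exists c : dcell D, dlab c = x) <-> (exists c : dcell D', dlab c = x).
Proof.
case=> f [[g fK gK] fl _] x; split=> -[c <-]; first by exists (f c).
by exists (g c); rewrite -fl gK.
Qed.

(** * The sweep from right to left *)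

Definition gaps (i : nat) : seq nat :=
  [seq g <- iota 0 (width W i).+1 | bounded_face W (Face i g)].

Fixpoint subsequences (l : seq nat) : seq (seq nat) :=
  if l is x :: l' then [seq x :: r | r <- subsequences l'] ++ subsequences l' else [:: [::]].

Definition walls_match (i : nat) (A B : seq nat) : bool :=
  all (fun f => valid_cell W (Wall i f) ==> ((left_gap W i f \in A) == (f \in B)))
      (iota 0 (width W i.+1).+1).

(** Positive quadrants are offered only on wall [j], the wall of the prescribed positive corner. *)
Definition stars_at (j : nat) (x : cell) : seq (seq cell) :=
  faces_at W x :: sides W x ++
  (if at_crossing W x then
     [seq quadrant_faces x q | q <- if x is Vert i _ then
        if i == j then [:: QLeft; QRight; QTop; QBottom] else [:: QTop; QBottom] else [::]]
   else [::]).

Definition vert_match (j i : nat) (A B : seq nat) : bool :=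
  all (fun v => valid_cell W (Vert i v) ==>
        let s := [seq f <- map (Face i) A ++ map (Face i.+1) B | incident W (Vert i v) f] in
        if s is [::] then true
        else has (fun s' => all (mem s) s' && all (mem s') s) (stars_at j (Vert i v)))
      (iota 0 (width W i.+1).+1).

(** Face sets in the slabs before [i] that fit the set [B] of gaps occupied in slab [i]. The sweep
    is started beyond the last wall, with [B] empty. *)
Fixpoint sweep (j i : nat) (B : seq nat) : seq (seq cell) :=
  if i is i'.+1 then
    flatten [seq [seq map (Face i') A ++ F | F <- sweep j i' A]
            | A <- subsequences (gaps i') & if walls_match i' A B then vert_match j i' A B else false]
  else [:: [::]].

Definition face_sets (j : nat) : seq (seq cell) :=
  [seq F <- sweep j (size W).+1 [::] | F != [::]].

Definition closure_of (F : seq cell) : seq cell :=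
  [seq x <- cells W | (x \in F) || has (incident W x) F].

Lemma mem_subsequences (a : pred nat) l : [seq x <- l | a x] \in subsequences l.
Proof.
elim: l => //= x l IHl; rewrite mem_cat; case: (a x); last by rewrite IHl orbT.
by rewrite map_f.
Qed.

Section Completeness.

Variable D : disk_data.
Hypothesis HD : immersed_disk W D.
Hypothesis Wok : locally_ok W.
Hypothesis Dinj : injective (@dlab D).
Variables j v : nat.
Hypothesis pos : dlab (dpos D) = Vert j v.

Definition column (i : nat) : seq nat :=
  [seq g <- gaps i | [exists d : dcell D, dlab d == Face i g]].

Lemma mem_column i g : reflect (exists d : dcell D, dlab d = Face i g) (g \in column i).
Proof.
apply: (iffP idP) => [|[d Ed]].
  by rewrite mem_filter => /andP[/existsP[d /eqP Ed] _]; exists d.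
have [] := disk_valid HD d; rewrite Ed => /andP[_ le] bd.
rewrite !mem_filter bd mem_iota ltnS le !andbT.
by apply/existsP; exists d; rewrite Ed.
Qed.

Lemma walls_column i : walls_match i (column i) (column i.+1).
Proof.
apply/allP=> f _; apply/implyP=> vw; apply/eqP; apply/idP/idP=> /mem_column[d Ed]; apply/mem_column.
  have [e _ Ee] : exists2 e, dinc e d & dlab e = Wall i f.
    by apply: (cell_in_closure HD) => //; rewrite Ed /= !eqxx orbT.
  by have [x [y [_ _ _ Ey]]] := wall_faces HD Wok Ee; exists y.
have [e _ Ee] : exists2 e, dinc e d & dlab e = Wall i f.
  by apply: (cell_in_closure HD) => //; rewrite Ed /= !eqxx.
by have [x [y [_ Ex _ _]]] := wall_faces HD Wok Ee; exists x.
Qed.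

Lemma star_allowed_at (c : dcell D) : is_vert (dlab c) ->
  exists2 s, s \in stars_at j (dlab c) & star c =i s.
Proof.
move=> vc; have [full|[s sin ps]|[q cq]] := disk_vert HD vc.
- exists (faces_at W (dlab c)); first by rewrite inE eqxx.
  move=> x; rewrite mem_filter mem_cells; apply/idP/idP=> [/mem_starP[d cd [<- ->]]|].
    by rewrite (disk_incident HD cd) (cell_valid HD).
  by case/andP=> /andP[fx ix] vx; apply: full.
- by exists s; [rewrite inE mem_cat sin orbT | apply: perm_mem].
- have cpos : corner W QLeft c \/ corner W QRight c -> dlab c = Vert j v.
    by move/(positive_dpos HD)=> ->.
  have [atc pq] := andP cq; exists (quadrant_faces (dlab c) q); last exact: perm_mem.
  rewrite /stars_at atc; case Ec: (dlab c) atc vc => [i u|//|//|//] _ _.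
  case: eqP => [_|ij].
    by case: q {cq pq}; rewrite !inE !mem_cat !inE eqxx ?orbT.
  case: q cq {pq} => cq; last 2 first.
    - by rewrite !inE !mem_cat !inE eqxx ?orbT.
    - by rewrite !inE !mem_cat !inE eqxx ?orbT.
    by case: ij; move: (cpos (or_introl cq)); rewrite Ec => -[].
  by case: ij; move: (cpos (or_intror cq)); rewrite Ec => -[].
Qed.

(** By injectivity, all faces of the disk around one point of the plane belong to the star of a
    single vertex, so together they form an admissible star. *)
Lemma vert_column i : vert_match j i (column i) (column i.+1).
Proof.
apply/allP=> u _; apply/implyP=> vu; set s := filter _ _.
have mem_s f : (f \in s) = incident W (Vert i u) f && [exists d : dcell D, (dlab d == f) && is_face f].
  rewrite mem_filter mem_cat; case inc: (incident _ _ _) => //=.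
  apply/orP/existsP=> [[]/mapP[g /mem_column[d Ed] ->]|[d /andP[/eqP Ed]]].
  - by exists d; rewrite Ed eqxx.
  - by exists d; rewrite Ed eqxx.
  case: f inc Ed => // k g /= inc Ed _; case/orP: inc => [/andP[/eqP kE _]|/andP[/eqP kE _]].
    by right; rewrite kE; apply: map_f; apply/mem_column; exists d; rewrite Ed kE.
  by left; rewrite kE; apply: map_f; apply/mem_column; exists d; rewrite Ed kE.
case: (boolP [exists c : dcell D, dlab c == Vert i u]) => [/existsP[c /eqP Ec]|nc].
  have vc : is_vert (dlab c) by rewrite Ec.
  have [s' sin ss] := star_allowed_at vc; rewrite Ec in sin.
  have Es : star c =i s.
    move=> f; rewrite mem_s; apply/mem_starP/andP=> [[d cd [Ed ff]]|[inc /existsP[d /andP[/eqP Ed ff]]]].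
      split; last by apply/existsP; exists d; rewrite Ed eqxx.
      by rewrite -Ed -Ec; apply: (disk_incident HD).
    rewrite -Ed in inc; have [c' c'd Ec'] := cell_in_closure HD vu inc.
    by exists d => //; rewrite -(Dinj (etrans Ec' (esym Ec))).
  have H : has (fun s0 => all (mem s) s0 && all (mem s0) s) (stars_at j (Vert i u)).
    apply/hasP; exists s' => //.
    by apply/andP; split; apply/allP=> f; rewrite /= -Es -ss.
  by case: (s) H.
case E: (s) => [//|f l]; have : f \in s by rewrite E inE eqxx.
rewrite mem_s => /andP[inc /existsP[d /andP[/eqP Ed _]]]; rewrite -Ed in inc.
have [c _ Ec] := cell_in_closure HD vu inc.
by case/existsP: nc; exists c; rewrite Ec.
Qed.

Fixpoint columns (i : nat) : seq cell :=
  if i is i'.+1 then map (Face i') (column i') ++ columns i' else [::].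

Lemma columns_sweep i : columns i \in sweep j i (column i).
Proof.
elim: i => // i IHi; apply/flattenP.
exists [seq map (Face i) (column i) ++ F | F <- sweep j i (column i)]; last exact: map_f.
apply: (map_f (fun A => [seq map (Face i) A ++ F | F <- sweep j i A])).
by rewrite mem_filter walls_column vert_column mem_subsequences.
Qed.

Lemma mem_columns i f : (f \in columns i) =
  [exists d : dcell D, (dlab d == f) && is_face f && (slab f < i)].
Proof.
elim: i => [|i IHi]; first by rewrite in_nil; apply/esym/existsP=> -[d]; rewrite andbF.
rewrite mem_cat IHi; apply/orP/existsP=> [[/mapP[g /mem_column[d Ed] ->]|/existsP[d /andP[df lt]]]|].
- by exists d; rewrite Ed eqxx /=.
- by exists d; rewrite df ltnW.
case=> d /andP[/andP[/eqP Ed ff]]; rewrite ltnS leq_eqVlt => /orP[/eqP si|lt]; [left|right].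
  by case: f si ff Ed {IHi} => //= k g -> _ Ed; apply: map_f; apply/mem_column; exists d.
by apply/existsP; exists d; rewrite Ed eqxx ff lt.
Qed.

Lemma mem_all_columns f :
  (f \in columns (size W).+1) = [exists d : dcell D, (dlab d == f) && is_face f].
Proof.
rewrite mem_columns; apply: eq_existsb => d; rewrite andb_idr // => /andP[/eqP Ed ff].
have fd : is_face (dlab d) by rewrite Ed.
by rewrite -Ed ltnS; case: (face_bounded HD fd).
Qed.

Lemma columns_face_set : columns (size W).+1 \in face_sets j.
Proof.
have nv : ~~ is_face (dlab (dpos D)) by rewrite pos.
have [d _ fd] := disk_pure HD nv.
rewrite mem_filter; apply/andP; split.
  have : dlab d \in columns (size W).+1.
    by rewrite mem_all_columns; apply/existsP; exists d; rewrite eqxx.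
  by apply: contraTneq => ->.
(* There is no slab beyond the last wall, so the column there is the empty one from which the sweep
   starts. *)
have -> : [::] = column (size W).+1; last exact: columns_sweep.
apply/esym; case E: (column _) => [//|g l]; have : g \in column (size W).+1 by rewrite E inE eqxx.
case/mem_column=> e Ee; have := cell_valid HD e.
by rewrite Ee /= ltnn.
Qed.

Lemma mem_closure_columns x :
  reflect (exists c : dcell D, dlab c = x) (x \in closure_of (columns (size W).+1)).
Proof.
rewrite mem_filter mem_cells mem_all_columns.
apply: (iffP andP) => [[/orP[/existsP[d /andP[/eqP Ed _]]|/hasP[f]] vx]|[c Ec]].
- by exists d.
- move: vx; rewrite mem_all_columns => /existsP[d /andP[/eqP Ed ff]] inc vx; rewrite -Ed in inc.
  by have [c _ Ec] := cell_in_closure HD vx inc; exists c.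
split; last by rewrite -Ec (cell_valid HD).
case: (boolP (is_face x)) => [fx|nf].
  by apply/orP; left; apply/existsP; exists c; rewrite Ec eqxx.
rewrite -Ec in nf; have [d cd fd] := disk_pure HD nf.
apply/orP; right; apply/hasP; exists (dlab d); last by rewrite -Ec; apply: (disk_incident HD).
by rewrite mem_all_columns; apply/existsP; exists d; rewrite eqxx.
Qed.

End Completeness.

(** The boundary is guessed by following successors from an edge that leaves the positive corner.
    Defaults returned by a failed search do no harm, because [model_ok] checks the result. *)
Definition trace (p : cell) (s : seq cell) : seq cell :=
  let bs := [seq e <- p :: s | lboundary p s e] in
  traject (fun e => nth p bs (find (lconsec p s e) bs))
          (nth p bs (find (fun e => lsource p s e p) bs)) (size bs).

Definition pos_vert (j : nat) : cell := Vert j (spot (ev W j)).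
Definition other_cells (j : nat) (F : seq cell) : seq cell := rem (pos_vert j) (closure_of F).
Definition disk_of (j : nat) (F : seq cell) : disk_data :=
  model (pos_vert j) (other_cells j F) (trace (pos_vert j) (other_cells j F)).
Definition disk_list (j : nat) : seq disk_data := map (disk_of j) (face_sets j).

(** The conditions of the sweep are local, so a set that it returns could be disconnected or have
    the wrong Euler characteristic. This check certifies that no such set occurs for wall [j], and
    that no disk is listed twice. *)
Definition disks_ok (j : nat) : bool :=
  let Fs := face_sets j in
  uniq [seq closure_of F | F <- Fs] &&
  all (fun F => (pos_vert j \in closure_of F) &&
    model_ok (pos_vert j) (other_cells j F) (trace (pos_vert j) (other_cells j F))) Fs.

(** Members of the list are disks by evaluation; they are pairwise non-isomorphic because an
    isomorphism preserves the set of labels; and any disk is isomorphic to the model on the face set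
    formed by its own columns. *)
Theorem all_disks_list (n j : nat) :
  (forall i, n <= i < size W -> ev W i = Cross (i - n).*2) ->
  width W (size W) = (size W - n).*2 ->
  locally_ok W -> trans_ok -> disks_ok j -> all_disks W j (disk_list j).
Proof.
move=> tail tw Wok tok /andP[uF /allP Fok].
have labels F : F \in face_sets j -> forall x,
    (exists c : dcell (disk_of j F), dlab c = x) <-> x \in closure_of F.
  move=> /Fok/andP[pin _] x.
  have E : x \in closure_of F <-> x \in pos_vert j :: other_cells j F.
    by rewrite (perm_mem (perm_to_rem pin)).
  rewrite E; split=> [[c <-]|/mem_model H]; first by apply: mem_nth.
  exact: H.
split.
- move=> i D; rewrite /disk_list onth_map; case E: (onth _ i) => [F|] //= [<-].
  have Fin : F \in face_sets j by apply/onthP; exists i.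
  have [_ Mok] := andP (Fok F Fin).
  split; first exact: model_disk.
  by exists (spot (ev W j)).
- move=> i i' D D'; rewrite /disk_list !onth_map.
  case E: (onth _ i) => [F|] //= [<-]; case E': (onth _ i') => [F'|] //= [<-] iso.
  have Fin : F \in face_sets j by apply/onthP; exists i.
  have Fin' : F' \in face_sets j by apply/onthP; exists i'.
  have same x : (x \in closure_of F) = (x \in closure_of F').
    have [H1 H2] := iso_labels iso x; have [H3 H4] := labels _ Fin x.
    have [H5 H6] := labels _ Fin' x.
    by apply/idP/idP=> [/H4/H1/H5|/H6/H2/H3].
  have cc : closure_of F = closure_of F'.
    apply: eq_in_filter => x xin; have := same x.
    by rewrite mem_filter [in RHS]mem_filter xin !andbT.
  apply: (@onth_inj _ _ i i' uF); last by rewrite !onth_map E E' /= cc.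
  by rewrite size_map gtn_min -!onthTE E E'.
- move=> D [HD [v Ev]].
  have Dinj := dlab_inj HD Wok tail tw.
  have := columns_face_set HD Wok Dinj Ev.
  set F := columns D _ => Fin.
  exists (index F (face_sets j)), (disk_of j F); split.
    by rewrite /disk_list onth_map (onthE _ _) (nth_map [::]) ?index_mem //= nth_index.
  have /andP[pin Mok] := Fok _ Fin.
  apply: model_iso => //; first exact: model_uniq Mok.
  move=> x; rewrite -(perm_mem (perm_to_rem pin)); exact: mem_closure_columns.
Qed.

End Model.

End Geometry.

(** * Augmentations and linearization *)

Lemma coef_int_poly (R : nzRingType) (z : int) i :
  (z%:~R : {poly R})`_i = if i == 0%N then z%:~R else 0.
Proof. by rewrite (_ : z%:~R = (z%:~R)%:P) ?coefC // rmorph_int. Qed.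

Lemma coef_affine (R : nzRingType) (x : R) (z : int) :
  (('X * x%:P + z%:~R)`_0 = z%:~R) * (('X * x%:P + z%:~R)`_1 = x).
Proof. by rewrite !coefD !coefXM !coef_int_poly coefC /= add0r addr0. Qed.

Lemma coef1M (R : nzRingType) (p q : {poly R}) : (p * q)`_1 = p`_0 * q`_1 + p`_1 * q`_0.
Proof. by rewrite coefM !big_ord_recl big_ord0 addr0. Qed.

Lemma mcoeffMz (K : choiceType) (x : {malg int[K]}) (z : int) m : (x *~ z)@_m = x@_m * z.
Proof. by rewrite raddfMz /= -mulrzr intz. Qed.

Section Evaluation.

Variables (w : seq event) (value : letter w -> int).

Definition eval_monom (u : {fmonom (letter w)}) : int := \prod_(l <- (u : seq (letter w))) value l.

Fact eval_monom_mmorphism : mmorphism eval_monom.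
Proof.
by split=> [u v|]; rewrite /eval_monom ?fmM ?big_cat // fm1 big_nil.
Qed.

HB.instance Definition _ :=
  monalg.isMultiplicative.Build {fmonom (letter w)} int eval_monom eval_monom_mmorphism.

Definition eval : {rmorphism free_alg w -> int} := mmap (idfun : {rmorphism int -> int}) eval_monom.

Lemma eval_gen l : eval (gen l) = value l.
Proof. by rewrite /eval /gen /= mmapU mul1r /eval_monom fmU big_seq1. Qed.

Lemma eval_word u : eval (word u) = \prod_(l <- u) value l.
Proof. by rewrite rmorph_prod; apply: eq_bigr => l _; rewrite eval_gen. Qed.

Lemma word_monom (u : seq (letter w)) : exists2 m : {fmonom (letter w)}, m = u :> seq _ & word u = << m >>.
Proof.
elim: u => [|l u [m mE uE]].
  by exists (fmone _); [rewrite fmoneE|rewrite /word big_nil].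
exists (fmmul (fmu l) m); first by rewrite fmmulE /= fmU mE.
rewrite /word big_cons -/(word u) uE /gen malgME !msuppU1 !big_seq_fset1.
by rewrite !mcoeffU1 !eqxx mulr1.
Qed.

Section Diff.
Variable d : chord w -> free_alg w.

(** By the Leibniz rule every term of the differential of a word has a factor [d a] or 0, so the
    augmentation equation need only be checked on chords. *)
Lemma eval_diff x : (forall a, eval (d a) = 0) -> eval (diff d x) = 0.
Proof.
move=> d0; rewrite rmorph_sum big1 // => u _.
rewrite rmorphMz (_ : eval (diff_word d u) = 0) ?mul0rz //.
elim: (u : seq _) => [|l v IHv] /=; first by rewrite rmorph0.
rewrite (rmorphD eval) [X in X + _](rmorphM eval) [X in _ + X](rmorphM eval).
rewrite [eval (gen l * _)](rmorphM eval) IHv !mulr0 addr0; case: l => [a|c] /=; first by rewrite d0 mul0r.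
by rewrite (rmorph0 eval) mul0r.
Qed.

(** The coefficient of [b] in the derivative at s = 0 of the substituted word: one summand for each
    occurrence of [b], all other letters being evaluated. *)
Fixpoint linear_part (b : chord w) (u : seq (letter w)) : int :=
  if u is l :: v then
    value l * linear_part b v + (l == inl b)%:R * \prod_(l' <- v) value l'
  else 0.

Lemma coef_subst_letter (l : letter w) :
  ((subst_letter eval l)`_0 = (value l)%:~R) * ((subst_letter eval l)`_1 = if l is inl _ then gen l else 0).
Proof.
case: l => [a|c]; rewrite /subst_letter eval_gen; first exact: coef_affine.
by split; apply: coef_int_poly.
Qed.

Lemma coef_subst_word b (u : seq (letter w)) (p := \prod_(l <- u) subst_letter eval l) :
  (p`_0 = (\prod_(l <- u) value l)%:~R) * ((p`_1)@_(fmu (inl b : letter w)) = linear_part b u).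
Proof.
rewrite {}/p; elim: u => [|l u [IH0 IH1]].
  by rewrite !big_nil -[1]/(1%:~R) !coef_int_poly; split=> //; apply: mcoeff0.
have [l0 l1] := coef_subst_letter l.
rewrite !big_cons coef0M coef1M IH0 l0 l1 rmorphM; split=> //.
rewrite mulrzl mulrzr mcoeffD; congr (_ + _).
  by rewrite mcoeffMz IH1 mulrC.
rewrite mcoeffMz; congr (_ * _).
case: l {l0 l1} => [a|c]; last by rewrite mcoeff0.
by rewrite mcoeffU1 -val_eqE /= !fmU eqseq_cons andbT.
Qed.

Lemma lin_coefE b x :
  (((subst_eps eval x)^`()).[0])@_(fmu (inl b : letter w)) =
  mmap (idfun : {rmorphism int -> int}) (fun u : {fmonom (letter w)} => linear_part b u) x.
Proof.
rewrite horner_coef0 coef_deriv mulr1n /subst_eps coef_sum raddf_sum mmapE.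
apply: eq_bigr => u _ /=; rewrite -[_`_1]/(coefp 1 _) raddfMz /=.
by rewrite mcoeffMz (coef_subst_word b u).2 mulrC.
Qed.

End Diff.
End Evaluation.

Lemma has_filter_pred (T : Type) (P Q : pred T) (s : seq T) :
  has P (filter Q s) = has (fun x => Q x && P x) s.
Proof. by elim: s => //= x s <-; case: (Q x). Qed.

(** * Words and signs computed from labels *)

Section Words.

Variables (w : seq event) (b : nat * nat) (o : bool).
Let W := resolution w.

(** Chords form a dependent type; naming them by their walls turns words into plain data that can be
    evaluated and compared with a table. *)
Definition letter_code (l : letter w) : nat + bool :=
  match l with inl a => inl (wall_of a) | inr c => inr c end.

Lemma wall_of_inj : injective (@wall_of w).
Proof. by move=> a a' /val_inj/val_inj. Qed.

Lemma letter_code_inj : injective letter_code.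
Proof. by case=> [a|c] [a'|c'] //= [] => [/wall_of_inj|] ->. Qed.

Lemma walls_enum : [seq wall_of a | a <- enum {: chord w}] =
  [seq j <- iota 0 (size W) | is_cross (ev W j)].
Proof.
have -> : enum {: chord w} = pmap insub (enum 'I_(size W)).
  by rewrite [LHS]enumT unlock [in RHS]enumT.
transitivity (map val (map (val : chord w -> 'I_(size W)) (pmap insub (enum 'I_(size W))))).
  by rewrite -map_comp.
rewrite pmap_filter; last exact: insubK.
rewrite -val_enum_ord filter_map; congr map.
by apply: eq_filter => i; rewrite /= isSome_insub.
Qed.

Section Model.
Variables (p : cell) (s bnd : seq cell).
Let S := p :: s.
Let M := model W p s bnd.

Definition lnegative (x : cell) : bool := lcorner W p s QTop x || lcorner W p s QBottom x.

Definition lletters (e : cell) : seq (nat + bool) :=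
  (if e == Strand b.1 b.2 then [:: inr (lrightward W p s e == o)] else [::]) ++
  [seq inl j | j <- [seq j <- iota 0 (size W) | is_cross (ev W j)] &
     has (fun c => lnegative c && (c == Vert j (spot (ev W j)))) [seq c <- S | ltarget W p s e c]].

Definition lword : seq (nat + bool) := flatten [seq lletters e | e <- bnd].

Lemma letters_model (e : dcell M) :
  [seq letter_code l | l <- disk_letters w b o e] = lletters (dlab e).
Proof.
rewrite /disk_letters /lletters map_cat; congr (_ ++ _).
  by rewrite rightward_model; case: ifP.
rewrite -walls_enum filter_map -!map_comp; congr map; apply: eq_filter => a.
transitivity (has (fun c => ltarget W p s (dlab e) c &&
  (lnegative c && (c == Vert (wall_of a) (spot (ev W (wall_of a)))))) S); last first.
  exact/esym/has_filter_pred.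
rewrite -(has_model W _ _ _ bnd); apply: eq_existsb => c.
by rewrite target_model /negative_corner !corner_model.
Qed.

Lemma word_model : model_ok W p s bnd ->
  [seq letter_code l | l <- disk_word w b o M] = lword.
Proof.
move=> ok; rewrite /disk_word map_flatten -map_comp /lword -[in RHS](map_dbound ok) -map_comp.
by congr flatten; apply: eq_map => e; apply: letters_model.
Qed.

Variable deg : nat -> int.
Hypothesis degE : forall j, (j < size W)%N -> is_cross (ev W j) -> wall_degree w j = deg j.

Definition leven (x : cell) : bool := if x is Vert j _ then ~~ odd `|deg j|%N else false.

Definition lsign : nat := count (fun x => lcorner W p s QBottom x && leven x) S.

Lemma sign_model : disk_sign w M = (-1) ^+ lsign.
Proof.
rewrite /disk_sign /lsign -(count_model W p s _ bnd); congr (_ ^+ _).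
apply: eq_card => c; rewrite !inE corner_model.
case cor: (lcorner _ _ _ _ _) => //=; case/andP: cor => + _.
case: (nth p (p :: s) c) => // j v /and3P[lt cr _].
by rewrite /even_at degE.
Qed.

End Model.

Definition terms (deg : nat -> int) (j : nat) : seq (nat * seq (nat + bool)) :=
  [seq let p := pos_vert W j in let s := other_cells W j F in
       (lsign p s deg, lword p s (trace W p s)) | F <- face_sets W j].

Variable v : nat + bool -> int.

Fixpoint coded_linear_part (x : nat + bool) (u : seq (nat + bool)) : int :=
  if u is l :: u' then v l * coded_linear_part x u' + (l == x)%:R * \prod_(l' <- u') v l' else 0.

Definition code_value (l : letter w) : int := v (letter_code l).

Lemma linear_part_code (a : chord w) u :
  linear_part code_value a u = coded_linear_part (inl (wall_of a)) (map letter_code u).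
Proof.
elim: u => //= l u ->; rewrite big_map; congr (_ + _ * _).
by rewrite -(inj_eq letter_code_inj).
Qed.

Variables (deg : nat -> int) (j : nat).
Hypothesis degE : forall j, (j < size W)%N -> is_cross (ev W j) -> wall_degree w j = deg j.
Hypothesis jok : disks_ok W j.

Lemma disks_model_ok F : F \in face_sets W j ->
  model_ok W (pos_vert W j) (other_cells W j F) (trace W (pos_vert W j) (other_cells W j F)).
Proof. by move=> Fin; case/andP: jok => _ /allP/(_ _ Fin)/andP[]. Qed.

Lemma eval_terms : eval code_value (disk_sum w b o (disk_list W j)) =
  \sum_(t <- terms deg j) (\prod_(l <- t.2) v l) * (-1) ^+ t.1.
Proof.
rewrite raddf_sum /disk_list /terms !big_map; apply: eq_big_seq => F /disks_model_ok Fok.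
rewrite raddfMz (sign_model _ _ _ degE) /= -mulrzr intz eval_word -(word_model Fok) big_map.
by [].
Qed.

Lemma lin_terms (d : chord w -> free_alg w) (a c : chord w) :
  d a = disk_sum w b o (disk_list W j) ->
  (lin_diff d (eval code_value) a)@_(fmu (inl c : letter w)) =
  \sum_(t <- terms deg j) coded_linear_part (inl (wall_of c)) t.2 * (-1) ^+ t.1.
Proof.
move=> da; rewrite /lin_diff lin_coefE da raddf_sum /disk_list /terms !big_map.
apply: eq_big_seq => F /disks_model_ok Fok.
rewrite raddfMz (sign_model _ _ _ degE) /= -mulrzr intz -(word_model Fok) -linear_part_code.
have [m mE ->] := word_monom (disk_word w b o (disk_of W j F)).
by rewrite mmapU mul1r mE.
Qed.

End Words.

(** * The knot *)

Lemma sum_foldr (T : Type) (s : seq T) (F : T -> int) :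
  \sum_(x <- s) F x = foldr (fun x y => F x + y) 0 s.
Proof. by elim: s => [|x s IHs]; rewrite ?big_nil ?big_cons ?IHs. Qed.

Lemma walkE w d : walk w d = traject (step w) d (sumn [seq width w j | j <- iota 0 (size w).+1]).
Proof. by rewrite /walk sumnE big_map -(big_mkord xpredT (width w)) /index_iota subn0. Qed.

Lemma nth_map_iota (T : Type) (f : nat -> T) x0 n j : (j < n)%N ->
  nth x0 [seq f i | i <- iota 0 n] j = f j.
Proof. by move=> lt; rewrite (nth_map 0%N) ?size_iota // nth_iota. Qed.

Definition knot : seq event :=
  [:: LCusp 0; LCusp 0; LCusp 0; Cross 1; Cross 3; Cross 2; Cross 2; Cross 1; Cross 1;
      Cross 3; Cross 3].

Definition knot_resolution : seq event :=
  [:: LCusp 0; LCusp 0; LCusp 0; Cross 1; Cross 3; Cross 2; Cross 2; Cross 1; Cross 1;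
      Cross 3; Cross 3; Cross 0; Cross 2; Cross 4].

Lemma resolution_knot : resolution knot = knot_resolution.
Proof. by []. Qed.

Lemma knot_is_knot : is_knot knot.
Proof.
split=> //; first by do 11?case.
(* The slabs contain 2 + 4 + 9 * 6 = 60 pieces of strand, and the knot passes through each of them
   once. *)
have /allP ok : all (fun p => has (fun d => d.2 == p) (traject (step knot) origin 60))
    [seq (j, h) | j <- iota 0 12, h <- iota 0 (width knot j)] by vm_compute.
move=> j h lej lth; have /hasP[d] : has (fun d => d.2 == (j, h)) (traject (step knot) origin 60).
  by apply: ok; apply/allpairsPdep; exists j, h; rewrite !mem_iota.
by case/trajectP=> i _ -> /eqP E; exists i, (iter i (step knot) origin).1; rewrite -E -surjective_pairing.
Qed.

Lemma knot_rotation : cusp_total knot = 0.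
Proof. by rewrite /cusp_total sum_foldr walkE; vm_compute. Qed.

(* Degrees by walls; walls 0, 1 and 2 carry left cusps and their entries are junk. *)
Definition deg (j : nat) : int :=
  nth 0 [:: 0; 0; 0; 0; 0; 1; -1; 0; 0; 0; 0; 1; 1; 1] j.

Lemma degE j : (j < size (resolution knot))%N -> is_cross (ev (resolution knot) j) ->
  wall_degree knot j = deg j.
Proof.
rewrite resolution_knot /wall_degree /front_degree sum_foldr walkE.
by do 14?[case: j => [|j] //]; vm_compute.
Qed.

(* For each wall, the words of the differential of its chord, preceded by the
   exponent of -1 in their sign; inl j is the chord on wall j and inr true is t. *)
Definition boundary_terms : seq (seq (nat * seq (nat + bool))) :=
  [:: [::]; [::]; [::]; [::]; [::];
      [:: (1, [:: inl 4; inl 3])]; [::];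
      [:: (1, [:: inl 6; inl 4])]; [::];
      [:: (0, [:: inl 3; inl 6])]; [::];
      [:: (0, [:: inr true]); (1, [:: inl 3]); (1, [:: inl 8]);
          (1, [:: inl 8; inl 6; inl 5]); (3, [:: inl 8; inl 7; inl 3])];
      [:: (0, [::]); (1, [:: inl 4; inl 8]); (1, [:: inl 10; inl 3]); (1, [:: inl 10; inl 8]);
          (1, [:: inl 10; inl 3; inl 7; inl 8]); (3, [:: inl 10; inl 9; inl 4; inl 8])];
      [:: (0, [::]); (0, [:: inl 4]); (0, [:: inl 10]);
          (0, [:: inl 5; inl 6; inl 10]); (0, [:: inl 4; inl 9; inl 10])]]%N.

Lemma knot_terms : [seq terms knot (14, 0)%N true deg j | j <- iota 0 14] = boundary_terms.
Proof. vm_cast_no_check (erefl boundary_terms). Qed.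

Lemma knot_termsE j : (j < 14)%N -> terms knot (14, 0)%N true deg j = nth [::] boundary_terms j.
Proof. by move=> lt; rewrite -knot_terms nth_map_iota. Qed.

Lemma knot_local : locally_ok knot_resolution && trans_ok knot_resolution.
Proof. vm_cast_no_check (erefl true). Qed.

Lemma knot_disks_all : all (disks_ok knot_resolution) (iota 0 14).
Proof. vm_cast_no_check (erefl true). Qed.

Lemma knot_disks j : (j < 14)%N -> disks_ok knot_resolution j.
Proof. by move=> lt; apply: (allP knot_disks_all); rewrite mem_iota. Qed.

Definition knot_diff (a : chord knot) : free_alg knot :=
  disk_sum knot (14, 0)%N true (disk_list (resolution knot) (wall_of a)).

Lemma wall_lt (a : chord knot) : (wall_of a < 14)%N.
Proof. by case: a => -[i lt] cr; exact: lt. Qed.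

Lemma wall_cross (a : chord knot) : is_cross (ev knot_resolution (wall_of a)).
Proof. exact: (valP a). Qed.

Lemma knot_resolution_tail i : (11 <= i < size knot_resolution)%N -> ev knot_resolution i = Cross (i - 11).*2.
Proof. by do 14?[case: i => [|i] //]. Qed.

Lemma knot_all_disks (a : chord knot) :
  all_disks (resolution knot) (wall_of a) (disk_list (resolution knot) (wall_of a)).
Proof.
have [lok tok] := andP knot_local; rewrite resolution_knot.
exact: (all_disks_list knot_resolution_tail erefl lok tok (knot_disks (wall_lt a))).
Qed.

(** Write xj for the value at chord j. With x4, x6 and x7 equal to 0, the equations from walls 11,
    12 and 13 become t = x3 + x8, x10 (x3 + x8) = 1 and x10 = -1. They fix only the sum of x3 and
    x8, which must be -1, so x3 is free; this freedom produces every n on the same knot. *)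
Definition chord_value (n : nat) (x : nat + bool) : int :=
  match x with
  | inl 3 => - n%:Z | inl 8 => n%:Z - 1 | inl 10 => -1 | inr _ => -1 | _ => 0
  end.

Lemma knot_degree (a : chord knot) : degree a = deg (wall_of a).
Proof. exact: (degE (wall_lt a) (wall_cross a)). Qed.

Definition knot_aug (n : nat) : {rmorphism free_alg knot -> int} :=
  eval (code_value (chord_value n)).

Lemma knot_aug_diff n (a : chord knot) : knot_aug n (knot_diff a) = 0.
Proof.
rewrite /knot_diff (eval_terms _ _ _ degE) ?resolution_knot ?knot_disks ?wall_lt //.
rewrite knot_termsE ?wall_lt //; move: (wall_of a) (wall_lt a).
case=> [|[|[|[|[|[|[|[|[|[|[|[|[|[|j]]]]]]]]]]]]]] //= lt;
  rewrite ?big_cons ?big_nil /=; lia.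
Qed.

Lemma knot_augmentation n : augmentation knot_diff (knot_aug n).
Proof.
split=> [|||a].
- by rewrite (rmorphM (knot_aug n)) !eval_gen.
- by rewrite (rmorphM (knot_aug n)) !eval_gen.
- by move=> x; apply: eval_diff; apply: knot_aug_diff.
rewrite knot_degree eval_gen /code_value /=.
by move: (wall_of a) (wall_lt a); case=> [|[|[|[|[|[|[|[|[|[|[|[|[|[|j]]]]]]]]]]]]]].
Qed.

(** Chord 7 contributes minus the value at 4, which is 0, and chord 9 contributes the value at 3. *)
Lemma knot_linear n (a c : chord knot) : degree a = 0 -> wall_of c = 6%N ->
  (lin_diff knot_diff (knot_aug n) a)@_(fmu (inl c : letter knot)) =
  if wall_of a == 9%N then - n%:Z else 0.
Proof.
rewrite knot_degree => da c6.
rewrite (lin_terms _ degE _ _ (erefl (knot_diff a))) ?resolution_knot ?knot_disks ?wall_lt // c6.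
rewrite knot_termsE ?wall_lt //; move: (wall_of a) (wall_lt a) da.
case=> [|[|[|[|[|[|[|[|[|[|[|[|[|[|j]]]]]]]]]]]]]] //= lt dj;
  rewrite ?big_cons ?big_nil /= ?big_cons ?big_nil /=; lia.
Qed.

(** * Cyclic homology in degree -1 *)

Lemma Zp_intr_eq0 (n : nat) (z : int) : (1 < n)%N -> (z%:~R == 0 :> 'Z_n) = (n %| z)%Z.
Proof.
move=> n1; have natE (m : nat) : (m%:R == 0 :> 'Z_n) = (n %| m)%N.
  by rewrite -val_eqE /= val_Zp_nat.
by case: z => m; rewrite ?NegzE ?rmorphN ?oppr_eq0 dvdzE ?abszN natE.
Qed.

Section Quotient.

Local Open Scope quotient_scope.

(** The reduction of [phi] modulo [n] is onto, as [h] is a section of [phi], and its kernel consists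
    exactly of the boundaries; hence it identifies the homology with Z/n. *)
Lemma cyclic_homology (U V W : zmodType) (f : {additive U -> V}) (g : {additive V -> W})
    (n : nat) (phi : {additive V -> int}) (h : int -> V) :
  (1 < n)%N -> cancel h phi -> (forall v, g v = 0) ->
  (forall v, (exists u, f u = v) <-> (n %| phi v)%Z) ->
  has_cyclic_summand n (homology f g).
Proof.
move=> n1 hK g0 im.
pose psi (c : Defs.cycle g) : 'Z_n := (phi (cycle_val c))%:~R.
have psiB x y : psi (x - y) = psi x - psi y.
  by rewrite /psi -rmorphB -raddfB.
have ker c : (c \in @boundary_pred _ _ _ f g) = (psi c == 0).
  by rewrite Zp_intr_eq0 //; apply/asboolP/idP => [/im|H]; last apply/im.
have pi_eq x y : (\pi_(homology f g) x == \pi_(homology f g) y) = (psi x == psi y).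
  by rewrite -Quotient.idealrBE ker psiB subr_eq0.
have psi_repr c : psi (repr (\pi_(homology f g) c)) = psi c.
  by apply/eqP; rewrite -pi_eq reprK.
(* The complementary summand is the zero group, realized as the row vectors of length 0. *)
pose F (x : homology f g) : 'Z_n * 'rV[int]_0 := (psi (repr x), 0).
have FB : zmod_morphism F.
  move=> x y; rewrite /F; congr pair; last by rewrite subr0.
  by rewrite -psiB -[X in repr (X - _)]reprK -[X in repr (_ - X)]reprK -raddfB psi_repr.
pose FA : {additive homology f g -> ('Z_n * 'rV[int]_0)%type} :=
  HB.pack F (GRing.isZmodMorphism.Build _ _ F FB).
exists 'rV[int]_0, FA.
have cyc v : v \in cycle_pred g by rewrite inE g0.
have psi_h (z : 'Z_n) : psi (Cycle (cyc (h (z : nat)))) = z.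
  by change ((phi (h (z : nat)))%:~R = z); rewrite hK -pmulrn natr_Zp.
exists (fun z : 'Z_n * 'rV[int]_0 =>
  \pi_(homology f g) (Cycle (cyc (h (z.1 : nat))) : Defs.cycle g)) => [x|[z r]].
  by apply/eqP; rewrite -[X in _ == X]reprK pi_eq psi_h.
rewrite -[LHS]/(F _) /F psi_repr psi_h; congr pair.
by apply/rowP => -[].
Qed.

End Quotient.

Lemma sum_only (I : finType) (F : I -> int) i0 :
  (forall i, i != i0 -> F i = 0) -> \sum_i F i = F i0.
Proof. by move=> F0; rewrite (bigD1 i0) //= big1 ?addr0. Qed.

Lemma knot_homology n : (1 < n)%N -> has_cyclic_summand n (LCH knot_diff (knot_aug n) (-1)).
Proof.
move=> n1; have lt6 : (6 < size (resolution knot))%N by [].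
have cr6 : is_cross (ev (resolution knot) (Ordinal lt6)) by [].
have lt9 : (9 < size (resolution knot))%N by [].
have cr9 : is_cross (ev (resolution knot) (Ordinal lt9)) by [].
pose c6 : chord knot := exist _ (Ordinal lt6) cr6.
pose c9 : chord knot := exist _ (Ordinal lt9) cr9.
have d6 : degree c6 == -1 by rewrite knot_degree.
have d9 : degree c9 == -1 + 1 by rewrite knot_degree.
pose a6 : {a : chord knot | degree a == -1} := exist _ c6 d6.
pose a9 : {a : chord knot | degree a == -1 + 1} := exist _ c9 d9.
have only6 (a : {a : chord knot | degree a == -1}) : a = a6.
  apply/val_inj/wall_of_inj; case: a => a /=; rewrite knot_degree /=.
  by move: (wall_of a) (wall_lt a); case=> [|[|[|[|[|[|[|[|[|[|[|[|[|[|j]]]]]]]]]]]]]].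
have no2 (a : {a : chord knot | degree a == -1 - 1}) : False.
  case: a => a /=; rewrite knot_degree.
  by move: (wall_of a) (wall_lt a); case=> [|[|[|[|[|[|[|[|[|[|[|[|[|[|j]]]]]]]]]]]]]].
have phiB : zmod_morphism (fun v : chain knot (-1) => v a6) by move=> u v; rewrite !ffunE.
pose phi : {additive chain knot (-1) -> int} :=
  HB.pack (fun v : chain knot (-1) => v a6) (GRing.isZmodMorphism.Build _ _ _ phiB).
apply: (@cyclic_homology _ _ _ _ _ n phi (fun z => [ffun=> z])) => //.
- by move=> z; rewrite /phi /= ffunE.
- by move=> v; apply/ffunP=> a; case: (no2 a).
have lin (a : {a : chord knot | degree a == -1 + 1}) :
    (lin_diff knot_diff (knot_aug n) (val a))@_(fmu (inl (val a6) : letter knot)) =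
    if a == a9 then - n%:Z else 0.
  by rewrite knot_linear //; rewrite (eqP (valP a)).
have sum_lin (u : chain knot (-1 + 1)) :
    lin_boundary knot_diff (knot_aug n) (-1) u a6 = - (u a9 * n%:Z).
  rewrite ffunE (sum_only (i0 := a9)) => [|a /negPf na]; last by rewrite lin na mulr0.
  by rewrite lin eqxx mulrN.
move=> v; split=> [[u <-]|/dvdzP[q vq]].
  by rewrite -[phi _]/(lin_boundary knot_diff (knot_aug n) (-1) u a6) sum_lin -mulNr dvdz_mull.
(* The sign of [- q] cancels that of the coefficient [- n] in the linearized differential of chord
   9. *)
exists [ffun a => if a == a9 then - q else 0]; apply/ffunP=> a; rewrite (only6 a) sum_lin.
by rewrite ffunE eqxx mulNr opprK.
Qed.

Theorem proposition1p1 :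
  exists w : seq event,
    is_knot w /\ cusp_total w = 0 /\
    exists (b : nat * nat) (o : bool) (disks : chord w -> seq disk_data),
      valid_cell (resolution w) (Strand b.1 b.2) /\
      (forall a : chord w, all_disks (resolution w) (wall_of a) (disks a)) /\
      let d := fun a : chord w => disk_sum w b o (disks a) in
      forall n : nat, (2 <= n)%N ->
        exists eps : {rmorphism free_alg w -> int},
          augmentation d eps /\
          exists k : int, has_cyclic_summand n (LCH d eps k).
Proof.
exists knot; split; first exact: knot_is_knot.
split; first exact: knot_rotation.
(* The base point is on the lower strand of the loop at the lowest right cusp, so [t] occurs only in
   the word of the disk filling this loop. *)
exists (14, 0)%N, true, (fun a => disk_list (resolution knot) (wall_of a)).
split; first by [].
split; first exact: knot_all_disks.
move=> d n n1; exists (knot_aug n); split; first exact: knot_augmentation.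
by exists (-1); apply: knot_homology.
Qed.
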